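(* Let $0\le \delta<1/4$ and $0<c<(1-4\delta)/10$. Then there exists $n_0$ such that for every $n\ge n_0$ the following holds. Let $\mathcal{M}=\{M_1,\ldots,M_m\}$ be a non-intersecting family of $m\le (1-n^{-c})n^{1+\delta}$ matchings, each of size $n$, with $\Delta(\mathcal{M})\le (1-n^{-c})n$. Then $\mathcal{M}$ contains a full rainbow matching.
   Context: A family $\mathcal{M}=\{M_1,\ldots,M_m\}$ of matchings (sets of pairwise vertex-disjoint edges on a common vertex set) is non-intersecting if $M_i\cap M_j=\emptyset$ for all $1\le i<j\le m$, i.e. the graph $G$ whose edge set is $\bigcup_i M_i$ is a simple graph and the $M_i$ are the colour classes of a proper edge colouring of $G$. $\Delta(\mathcal{M})$ denotes the maximum degree of $G$. A full rainbow matching is a matching $M\subseteq \bigcup_i M_i$ containing exactly one edge from $M_i$ for each $1\le i\le m$. *)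

(* Defs.v *)
From mathcomp Require Import all_boot.

Set Implicit Arguments.
Unset Strict Implicit.
Unset Printing Implicit Defensive.

Section Matchings.

Variable T : finType.

(** An edge is a two-element set of vertices. Hence a set of edges is the edge
    set of a simple graph, and two edges are vertex-disjoint exactly when they
    are disjoint as sets. *)
Definition is_matching (M : {set {set T}}) : bool :=
  [forall e in M, #|e| == 2] && trivIset M.

Definition degree (G : {set {set T}}) (v : T) : nat :=
  #|[set e in G | v \in e]|.

Definition max_degree (G : {set {set T}}) : nat := \max_(v : T) degree G v.

Variable m : nat.
Variable M : 'I_m -> {set {set T}}.

Definition family_edges : {set {set T}} := \bigcup_(i < m) M i.

Definition non_intersecting : Prop :=
  forall i j : 'I_m, i < j -> M i :&: M j = set0.

Definition full_rainbow_matching (N : {set {set T}}) : Prop :=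
  [/\ is_matching N, N \subset family_edges
    & forall i : 'I_m, #|N :&: M i| = 1].

End Matchings.

(* Main.v *)
Require Import Defs.
From HB Require Import structures.
From mathcomp Require Import all_boot all_order all_algebra.
From mathcomp Require Import all_classical all_reals all_analysis.
From mathcomp Require Import ring lra.

Set Implicit Arguments.
Unset Strict Implicit.
Unset Printing Implicit Defensive.

Import Order.TTheory GRing.Theory Num.Theory.
Local Open Scope ring_scope.

(** A derandomised random greedy algorithm. One processes the colours in random
    order, and picks for the current colour a surviving edge [uv] with
    probability proportional to [w u * w v], where the weight [w x] of a vertex
    is [0] once [x] is covered. The weights of the surviving vertices are
    lowered at each step so that every vertex loses in expectation exactly the
    same fraction [h] of its weight, however small its degree. Hence the weight
    of a colour decreases on average by a factor at least [1 - 2 * h], and the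
    weighted degree of a vertex in the graph of the [k] unused colours by a
    factor about [(1 - h) * (1 - 1 / k)]. Since the degrees are at most
    [(1 - eps) * n], [h] may be chosen so that the fraction of a weight that
    is left stays above a linear function decreasing from [1] to [eps / 2].

    A sum of exponentials of all the colour weights and vertex degrees does not
    increase on average, so at each step some choice of colour and edge does not
    increase it; this keeps every colour weight above and every degree below its
    expected trajectory. Once only about [eps ^+ 2 * n / 20] colours are left,
    each of them still has weight of order [eps ^+ 2 * n], and since an edge
    meets at most two edges of each colour, the rest is done greedily. *)

(** * Exponential moments *)

(** From [expR (- z) >= 1 - z] alone, [expR z <= 1 / (1 - z) <= 1 + z + 2 * z ^+ 2] for
    [z <= 1 / 2]. The range [2 * z <= k] then turns the quadratic term into a relative error [k]. *)
Lemma expR_le_quad (R : realType) (k z : R) :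
  0 <= z -> z <= k / 2 -> k <= 1 -> expR z <= 1 + (1 + k) * z.
Proof.
move=> z_ge0 zk k1.
have z2 : z <= 1 / 2 by lra.
have e1 : 1 - z <= expR (- z) by rewrite expR_ge1Dx.
have e0 : expR z * expR (- z) = 1 by rewrite -expRD subrr expR0.
have ep : 0 < expR z by exact: expR_gt0.
have e2 : expR z * (1 - z) <= 1 by rewrite -[leRHS]e0 ler_pM2l.
have : expR z <= 1 + z + 2 * z ^+ 2.
  have z1 : 0 < 1 - z by lra.
  rewrite -(ler_pM2r z1); apply: (le_trans e2).
  suff : 0 <= z ^+ 2 * (1 - 2 * z) by nra.
  by apply: mulr_ge0; [exact: sqr_ge0|lra].
suff : 0 <= z * (k - 2 * z) by nra.
by apply: mulr_ge0; lra.
Qed.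

Lemma expRN_le_quad (R : realType) (k z : R) :
  0 <= z -> z <= k -> expR (- z) <= 1 - (1 - k) * z.
Proof.
move=> z_ge0 zk.
have e1 : 1 + z <= expR z by rewrite expR_ge1Dx.
have e0 : expR (- z) * expR z = 1 by rewrite -expRD addNr expR0.
have ep : 0 < expR (- z) by exact: expR_gt0.
have e2 : expR (- z) * (1 + z) <= 1 by rewrite -[leRHS]e0 ler_pM2l.
have : expR (- z) <= 1 - z + z ^+ 2.
  have z1 : 0 < 1 + z by lra.
  rewrite -(ler_pM2r z1); apply: (le_trans e2).
  suff : 0 <= z ^+ 2 * z by nra.
  by apply: mulr_ge0; [exact: sqr_ge0|lra].
suff : 0 <= z * (k - z) by nra.
by apply: mulr_ge0; lra.
Qed.

Section Mean.

Variables (R : realType) (O : finType) (P : O -> R).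
Hypotheses (P_ge0 : forall t, 0 <= P t) (P_sum1 : \sum_t P t = 1).

Lemma exists_le_mean (F : O -> R) (c : R) :
  \sum_t P t * F t <= c -> exists t, 0 < P t /\ F t <= c.
Proof.
move=> mean_le; apply/boolp.not_existsP => noF.
have gtF t : 0 < P t -> c < F t.
  by move=> Pt; rewrite ltNge; apply/negP => Fc; apply: (noF t).
have term_ge0 t : 0 <= P t * (F t - c).
  have := P_ge0 t; rewrite le_eqVlt => /orP[/eqP <-|Pt]; first by rewrite mul0r.
  by rewrite mulr_ge0 // subr_ge0 ltW // gtF.
have sum0 : \sum_t P t * (F t - c) = 0.
  apply/eqP; rewrite eq_le sumr_ge0 // andbT.
  under eq_bigr => t _ do rewrite mulrBr.
  by rewrite sumrB -mulr_suml P_sum1 mul1r subr_le0.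
have P0 t : P t = 0.
  apply/eqP; rewrite eq_le P_ge0 andbT leNgt; apply/negP => Pt.
  have /eqP : P t * (F t - c) = 0 by exact: (psumr_eq0P _ sum0).
  by rewrite mulf_eq0 gt_eqF //= subr_eq0 gt_eqF // gtF.
by have /eqP := P_sum1; rewrite big1 // eq_sym oner_eq0.
Qed.

(** On the bounded range of [l * X t] the exponential lies below a line, so its mean depends on the
    mean of [X] only, and [1 + y <= expR y] restores an exponential. *)
Lemma mean_expR_le (X : O -> R) (l k : R) :
  (forall t, 0 <= l * X t <= k / 2) -> k <= 1 ->
  \sum_t P t * expR (l * X t) <= expR (l * ((1 + k) * \sum_t P t * X t)).
Proof.
move=> Xb k1.
apply: (le_trans _ (expR_ge1Dx _)).
apply: (@le_trans _ _ (\sum_t (P t + (l * (1 + k)) * (P t * X t)))).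
  apply: ler_sum => t _.
  have /andP[X0 Xk] := Xb t.
  have -> : P t + l * (1 + k) * (P t * X t) = P t * (1 + (1 + k) * (l * X t)).
    by ring.
  by rewrite ler_wpM2l // expR_le_quad.
by rewrite big_split /= -mulr_sumr P_sum1 mulrA.
Qed.

Lemma mean_expRN_le (X : O -> R) (l k : R) :
  (forall t, 0 <= l * X t <= k) ->
  \sum_t P t * expR (- (l * X t)) <=
    expR (- (l * ((1 - k) * \sum_t P t * X t))).
Proof.
move=> Xb.
apply: (le_trans _ (expR_ge1Dx _)).
apply: (@le_trans _ _ (\sum_t (P t + (- (l * (1 - k))) * (P t * X t)))).
  apply: ler_sum => t _.
  have /andP[X0 Xk] := Xb t.
  have -> : P t + - (l * (1 - k)) * (P t * X t) =
      P t * (1 - (1 - k) * (l * X t)) by ring.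
  by rewrite ler_wpM2l // expRN_le_quad.
by rewrite big_split /= -mulr_sumr P_sum1 mulrA mulNr.
Qed.

End Mean.

(** * One step of the process *)

Lemma sum_triple (R : nmodType) (I T U : finType) (F : I * T * U -> R) :
  \sum_t F t = \sum_i \sum_u \sum_v F (i, u, v).
Proof.
rewrite (pair_bigA _ (fun i u => \sum_v F (i, u, v))) /=.
rewrite (pair_bigA _ (fun iu v => F (iu.1, iu.2, v))) /=.
by apply: eq_bigr => -[[i u] v].
Qed.

Lemma sum_subsingleton_le1 (R : numDomainType) (J : finType) (Q p : pred J)
    (g : J -> R) :
  (forall a b, p a -> p b -> a = b) -> (forall a, g a <= 1) ->
  \sum_(a | Q a) (p a)%:R * g a <= 1.
Proof.
move=> p_uniq g1.
case: (pickP (fun a => Q a && p a)) => [a /andP[Qa pa]|none]; last first.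
  rewrite big1 ?ler01// => a Qa; have := none a; rewrite Qa /= => ->.
  by rewrite mul0r.
rewrite (bigD1 a) //= pa mul1r big1 ?addr0 // => b /andP[_ ba].
case: (boolP (p b)) => pb; last by rewrite mul0r.
by rewrite (p_uniq _ _ pb pa) eqxx in ba.
Qed.

Lemma sum_indicator (R : pzRingType) (J : finType) (j : J) (F : J -> R) :
  \sum_a (a == j)%:R * F a = F j.
Proof.
rewrite (bigD1 j) //= eqxx mul1r big1 ?addr0 // => a /negPf ->.
by rewrite mul0r.
Qed.

(** * Weighted colours and degrees, and the greedy completion *)

Section Weights.

Variables (R : realType) (I T : finType) (E : I -> rel T).
Hypotheses (E_sym : forall i, symmetric (E i))
  (E_partner : forall i u v v', E i u v -> E i u v' -> v = v')
  (E_color : forall i j u v, E i u v -> E j u v -> i = j).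

(* Each edge is counted twice, once for each orientation. *)
Definition color_weight (w : T -> R) (i : I) : R :=
  \sum_u \sum_v (E i u v)%:R * (w u * w v).

Definition wdegree (C : {set I}) (w : T -> R) (x : T) : R :=
  \sum_(i in C) \sum_y (E i x y)%:R * w y.

Lemma partner_sum_le1 i u : \sum_v (E i u v)%:R <= 1 :> R.
Proof.
under eq_bigr do rewrite -[_%:R]mulr1.
by apply: sum_subsingleton_le1 => // a b; exact: E_partner.
Qed.

Lemma left_end_sum_le1 i x : \sum_u \sum_v (E i u v)%:R * (u == x)%:R <= 1 :> R.
Proof.
under eq_bigr => u _ do rewrite -mulr_suml mulrC.
by rewrite sum_indicator partner_sum_le1.
Qed.

Lemma right_end_sum_le1 i x : \sum_u \sum_v (E i u v)%:R * (v == x)%:R <= 1 :> R.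
Proof.
rewrite exchange_big /=.
by under eq_bigr do under eq_bigr do rewrite E_sym; exact: left_end_sum_le1.
Qed.

(** The constant is 4 because [a] and [b] each meet at most one edge of colour [i], counted in two
    orientations. *)
Lemma color_weight_drop_le (w w' : T -> R) (c : R) (a b : T) (i : I) :
  (forall u v, w u * w v - w' u * w' v <= c * (w u * w v) +
     ((u == a)%:R + (u == b)%:R + (v == a)%:R + (v == b)%:R)) ->
  color_weight w i - color_weight w' i <= c * color_weight w i + 4.
Proof.
move=> drop_le.
apply: (@le_trans _ _ (c * color_weight w i +
    (\sum_u \sum_v (E i u v)%:R * (u == a)%:R +
     \sum_u \sum_v (E i u v)%:R * (u == b)%:R +
     \sum_u \sum_v (E i u v)%:R * (v == a)%:R +
     \sum_u \sum_v (E i u v)%:R * (v == b)%:R))); last first.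
  rewrite lerD2l.
  have := left_end_sum_le1 i a; have := left_end_sum_le1 i b.
  have := right_end_sum_le1 i a; have := right_end_sum_le1 i b.
  lra.
rewrite -sumrB mulr_sumr -!big_split /=; apply: ler_sum => u _.
rewrite -sumrB mulr_sumr -!big_split /=; apply: ler_sum => v _.
by rewrite [c * _]mulrCA -!mulrDr -mulrBr; apply: ler_wpM2l.
Qed.

Definition endpoint (e : T * T) (x : T) : bool := (x == e.1) || (x == e.2).

Definition rainbow_on (C : {set I}) (w : T -> R) : Prop :=
  exists f : I -> T * T,
    (forall i, i \in C ->
       [/\ E i (f i).1 (f i).2, 0 < w (f i).1 & 0 < w (f i).2]) /\
    (forall i j x, i \in C -> j \in C ->
       endpoint (f i) x -> endpoint (f j) x -> i = j).

(** Disjointness from [u] and [v] needs no bookkeeping: the remaining edges have ends of positive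
    [w'], and [w'] vanishes at [u] and [v]. *)
Lemma rainbow_on_setD1 (C : {set I}) (w w' : T -> R) i u v :
  E i u v -> 0 < w u -> 0 < w v -> (forall x, w' x <= w x) ->
  w' u = 0 -> w' v = 0 -> rainbow_on (C :\ i) w' -> rainbow_on C w.
Proof.
move=> Eiuv wu wv w'w w'u w'v [f [f_edge f_disj]].
exists (fun j => if j == i then (u, v) else f j); split=> [j jC|].
  case: (eqVneq j i) => [->|ji]; first by split.
  have [|Ej w1 w2] := f_edge j; first by rewrite !inE ji.
  by split; rewrite ?(lt_le_trans _ (w'w _)).
have not_uv j x : j != i -> j \in C -> endpoint (u, v) x ->
    endpoint (f j) x -> False.
  move=> ji jC x_uv x_fj; have [|_ w1 w2] := f_edge j; first by rewrite !inE ji.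
  have : 0 < w' x by move: x_fj => /orP[] /eqP ->.
  by move: x_uv => /orP[] /eqP ->; rewrite /= ?w'u ?w'v ltxx.
move=> j j' x jC j'C.
case: (eqVneq j i) => [->|ji]; case: (eqVneq j' i) => [->|j'i] //.
- by move=> x_uv x_f; case: (not_uv j' x).
- by move=> x_f x_uv; case: (not_uv j x).
by apply: f_disj; rewrite !inE ?ji ?j'i.
Qed.

Lemma exists_weighted_edge (w : T -> R) i :
  (forall x, 0 <= w x) -> 0 < color_weight w i ->
  exists u v, [/\ E i u v, 0 < w u & 0 < w v].
Proof.
move=> w_ge0 s_gt0; apply: contrapT => none.
suff s0 : color_weight w i = 0 by rewrite s0 ltxx in s_gt0.
apply: big1 => u _; apply: big1 => v _.
case: (boolP (E i u v)) => Euv; last by rewrite mul0r.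
have := w_ge0 u; rewrite le_eqVlt => /orP[/eqP <-|wu]; first by rewrite mul0r mulr0.
have := w_ge0 v; rewrite le_eqVlt => /orP[/eqP <-|wv]; first by rewrite !mulr0.
by case: none; exists u, v.
Qed.

(** Covering the ends of a chosen edge costs every other colour at most 4, exactly the amount by
    which [4 * #|C|] decreases, so the hypothesis reproduces itself. *)
Lemma greedy_rainbow (x0 : T) (C : {set I}) (w : T -> R) :
  (forall x, 0 <= w x) -> (forall x, w x <= 1) ->
  (forall i, i \in C -> 4 * #|C|%:R <= color_weight w i) -> rainbow_on C w.
Proof.
have [N] := ubnP #|C|; elim: N => // N IH in C w *.
rewrite ltnS => CN w_ge0 w_le1 wC.
case: (set_0Vmem C) => [->|[i iC]].
  by exists (fun=> (x0, x0)); split=> [i|i j x]; rewrite inE.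
have card_C : #|C|%:R = 1 + #|C :\ i|%:R :> R by rewrite (cardsD1 i) iC natrD.
have [||u [v [Euv wu wv]]] := @exists_weighted_edge w i => //.
  by apply: lt_le_trans (wC i iC); rewrite card_C; have := ler0n R #|C :\ i|; lra.
pose w' x := (~~ endpoint (u, v) x)%:R * w x.
have w'_ge0 x : 0 <= w' x by rewrite mulr_ge0.
have w'w x : w' x <= w x by rewrite ler_piMl // lern1 leq_b1.
apply: (rainbow_on_setD1 Euv wu wv w'w).
- by rewrite /w' /endpoint eqxx mul0r.
- by rewrite /w' /endpoint eqxx orbT mul0r.
apply: IH => // [|x|j].
- by rewrite (leq_trans _ CN) // [X in (_ < X)%N](cardsD1 i) iC.
- exact: le_trans (w'w x) _.
rewrite !inE => /andP[_ jC].
have : color_weight w j - color_weight w' j <= 0 * color_weight w j + 4.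
  apply: (@color_weight_drop_le _ _ _ u v) => x y.
  have wxy : 0 <= w x * w y by rewrite mulr_ge0.
  have wxy1 : w x * w y <= 1 by rewrite mulr_ile1.
  rewrite /w' /endpoint /=.
  case: (x == u); case: (x == v); case: (y == u); case: (y == v);
    rewrite /= ?mul0r ?mulr0 ?mul1r; lra.
have := wC j jC; rewrite card_C; lra.
Qed.

(** * Expectations and maximal changes for one random edge *)

Section Step.

Variables (w : T -> R) (C : {set I}) (S h : R).
Hypotheses (w_ge0 : forall x, 0 <= w x) (w_le1 : forall x, w x <= 1)
  (S_gt0 : 0 < S) (weight_ge : forall i, i \in C -> S <= color_weight w i)
  (C_gt0 : (0 < #|C|)%N)
  (hdeg : forall x, 2 * wdegree C w x / (#|C|%:R * S) <= h) (h_lt1 : h < 1).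

Let k : R := #|C|%:R.

(** A uniform colour of [C], then an oriented edge of this colour with probability proportional to
    the product of its end weights. All other triples get probability 0, so sums run over the whole
    product type. *)
Definition prob (t : I * T * T) : R :=
  (t.1.1 \in C)%:R * ((E t.1.1 t.1.2 t.2)%:R * (w t.1.2 * w t.2))
    / (#|C|%:R * color_weight w t.1.1).

Definition killed (t : I * T * T) (x : T) : bool :=
  (x == t.1.2) || (x == t.2).

Definition kill_prob (x : T) : R := \sum_t prob t * (killed t x)%:R.

Definition color_kill_prob (i : I) (x : T) : R :=
  \sum_t prob t * ((t.1.1 == i) && killed t x)%:R.

Let k_gt0 : 0 < k. Proof. by rewrite ltr0n. Qed.

Let weight_gt0 i : i \in C -> 0 < color_weight w i.
Proof. by move/weight_ge; apply: lt_le_trans. Qed.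

Lemma prob_ge0 t : 0 <= prob t.
Proof.
rewrite /prob; case: (boolP (_ \in C)) => iC; last by rewrite !mul0r.
by rewrite mul1r divr_ge0 ?mulr_ge0 // ltW // weight_gt0.
Qed.

Lemma sum_prob_color i (F : T -> T -> R) : i \in C ->
  \sum_t prob t * ((t.1.1 == i)%:R * F t.1.2 t.2) =
  (k * color_weight w i)^-1 *
    \sum_u \sum_v (E i u v)%:R * (w u * w v) * F u v.
Proof.
move=> iC; rewrite sum_triple (bigD1 i) //= [X in _ + X]big1 ?addr0; last first.
  move=> j /negPf ji; rewrite big1 // => u _; rewrite big1 // => v _.
  by rewrite ji mul0r mulr0.
rewrite mulr_sumr; apply: eq_bigr => u _.
rewrite mulr_sumr; apply: eq_bigr => v _.
by rewrite /prob /= iC eqxx /k /=; ring.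
Qed.

Lemma prob_color i : i \in C -> \sum_t prob t * (t.1.1 == i)%:R = k^-1.
Proof.
move=> iC; have := sum_prob_color (fun _ _ => 1) iC.
under eq_bigr do rewrite mulr1.
move=> ->; under eq_bigr do under eq_bigr do rewrite mulr1.
by rewrite -/(color_weight w i) invfM -mulrA mulVf ?mulr1 // gt_eqF // weight_gt0.
Qed.

Lemma sum_split_color (F : I * T * T -> R) :
  \sum_t prob t * F t = \sum_(i in C) \sum_t prob t * ((t.1.1 == i)%:R * F t).
Proof.
rewrite exchange_big /=; apply: eq_bigr => t _.
rewrite -mulr_sumr -mulr_suml.
case: (boolP (t.1.1 \in C)) => iC; last by rewrite /prob (negPf iC) !mul0r.
rewrite (bigD1 t.1.1) //= eqxx big1 ?addr0 ?mul1r // => i /andP[_].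
by rewrite eq_sym => /negPf ->.
Qed.

Lemma sum_prob : \sum_t prob t = 1.
Proof.
have := sum_split_color (fun => 1).
under eq_bigr do rewrite mulr1.
move=> ->.
under eq_bigr => i iC.
  under eq_bigr do rewrite mulr1.
  rewrite prob_color //.
  over.
by rewrite sumr_const -[X in X *+ _]mulr1 -mulrnAr mulVf // gt_eqF.
Qed.

(** The factor 2 comes from orientations: [x] can be the first or the second end, and both cases
    contribute [w x * D]. *)
Lemma color_kill_prob_le i x : i \in C ->
  color_kill_prob i x <= 2 / (k * S) * (w x * \sum_y (E i x y)%:R * w y).
Proof.
move=> iC; rewrite /color_kill_prob.
under eq_bigr => t _ do rewrite -mulnb natrM.
rewrite (sum_prob_color (fun u v => ((x == u) || (x == v))%:R)) //.
set D := \sum_y (E i x y)%:R * w y.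
apply: (@le_trans _ _ ((k * color_weight w i)^-1 * (2 * (w x * D)))); last first.
  rewrite [leRHS]mulrAC [leRHS]mulrC.
  rewrite ler_wpM2r // ?lef_pV2 ?posrE ?mulr_gt0 ?weight_gt0 //.
    rewrite !mulr_ge0 // sumr_ge0 // => y _; exact: mulr_ge0.
  by rewrite ler_pM2l // weight_ge.
apply: ler_wpM2l; first by rewrite invr_ge0 ltW // mulr_gt0 // weight_gt0.
have Dl : \sum_u \sum_v (x == u)%:R * ((E i u v)%:R * (w u * w v)) = w x * D.
  under eq_bigr => u _ do rewrite -mulr_sumr eq_sym.
  by rewrite sum_indicator mulr_sumr; apply: eq_bigr => v _; ring.
have Dr : \sum_u \sum_v (x == v)%:R * ((E i u v)%:R * (w u * w v)) = w x * D.
  rewrite exchange_big /=.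
  under eq_bigr => u _ do rewrite -mulr_sumr eq_sym.
  rewrite sum_indicator mulr_sumr; apply: eq_bigr => v _.
  by rewrite E_sym; ring.
rewrite mulr_natl mulr2n -{1}Dl -Dr -big_split /=; apply: ler_sum => u _.
rewrite -big_split /=; apply: ler_sum => v _.
rewrite -mulrDl [leLHS]mulrC; apply: ler_wpM2r; first by rewrite !mulr_ge0.
by case: (x == u); case: (x == v); rewrite /= ?addr0 ?add0r // lerDl.
Qed.

Lemma kill_prob_le x : kill_prob x <= h.
Proof.
apply: le_trans (hdeg x).
rewrite /kill_prob sum_split_color.
apply: (@le_trans _ _
    (\sum_(i in C) 2 / (k * S) * \sum_y (E i x y)%:R * w y)); last first.
  by rewrite -mulr_sumr mulrAC.
apply: ler_sum => i iC.
under eq_bigr => t _ do rewrite -natrM mulnb.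
apply: (le_trans (color_kill_prob_le x iC)).
apply: ler_wpM2l; first by rewrite ltW // divr_gt0 // mulr_gt0.
rewrite ler_piMl // sumr_ge0 // => y _; exact: mulr_ge0.
Qed.

Lemma kill_prob_ge0 x : 0 <= kill_prob x.
Proof. by apply: sumr_ge0 => t _; rewrite mulr_ge0 // prob_ge0. Qed.

(* This factor makes the expected new weight of [x] equal to [(1 - h) * w x]. *)
Definition shrink (x : T) : R := (1 - h) / (1 - kill_prob x).

Definition new_weight (t : I * T * T) (x : T) : R :=
  (~~ killed t x)%:R * (w x * shrink x).

Let kill_lt1 x : 0 < 1 - kill_prob x.
Proof. by rewrite subr_gt0 (le_lt_trans (kill_prob_le x)). Qed.

Let h_ge0 (x : T) : 0 <= h.
Proof. exact: le_trans (kill_prob_ge0 x) (kill_prob_le x). Qed.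

Lemma shrink_ge x : 1 - h <= shrink x.
Proof.
rewrite ler_pdivlMr // ler_piMr ?subr_ge0 ?(ltW h_lt1) //.
by rewrite gerBl kill_prob_ge0.
Qed.

Lemma shrink_le1 x : shrink x <= 1.
Proof. by rewrite ler_pdivrMr // mul1r lerB // kill_prob_le. Qed.

Let shrink_ge0 x : 0 <= shrink x.
Proof. by rewrite (le_trans _ (shrink_ge x)) // subr_ge0 ltW. Qed.

Lemma new_weight_ge0 t x : 0 <= new_weight t x.
Proof. by rewrite mulr_ge0 // mulr_ge0. Qed.

Lemma new_weight_le t x : new_weight t x <= w x.
Proof.
rewrite /new_weight; case: (killed t x); rewrite /= ?mul0r ?mul1r //.
by rewrite ler_piMr // shrink_le1.
Qed.

(** By the union bound both vertices survive with probability at least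
    [1 - a - b = (1 - a) * (1 - b) - a * b], where [a] and [b] are the kill probabilities. As
    [a, b <= h], one has [a * (1 - h) <= h * (1 - a)] and likewise for [b]. So the shrunken product
    loses at most [h ^+ 2] from [(1 - h) ^+ 2], leaving [1 - 2 * h]. *)
Lemma survive_pair_ge u v :
  1 - 2 * h <= shrink u * shrink v *
    \sum_t prob t * ((~~ killed t u)%:R * (~~ killed t v)%:R).
Proof.
have ruv : 0 <= shrink u * shrink v by rewrite mulr_ge0.
apply: (@le_trans _ _ (shrink u * shrink v * (1 - kill_prob u - kill_prob v))).
  rewrite /shrink; set a := kill_prob u; set b := kill_prob v.
  have a0 : 0 <= a := kill_prob_ge0 u; have ah : a <= h := kill_prob_le u.
  have b0 : 0 <= b := kill_prob_ge0 v; have bh : b <= h := kill_prob_le v.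
  have a1 : 0 < 1 - a := kill_lt1 u; have b1 : 0 < 1 - b := kill_lt1 v.
  have -> : (1 - h) / (1 - a) * ((1 - h) / (1 - b)) * (1 - a - b) =
    (1 - h) ^+ 2 * (1 - a - b) / ((1 - a) * (1 - b)).
    by rewrite invfM expr2; ring.
  rewrite ler_pdivlMr ?mulr_gt0 //.
  have : a * (1 - h) * (b * (1 - h)) <= h * (1 - a) * (h * (1 - b)).
    have h1 : 0 <= 1 - h by rewrite subr_ge0 ltW.
    by apply: ler_pM; [exact: mulr_ge0|exact: mulr_ge0|lra|lra].
  lra.
apply: ler_wpM2l => //.
rewrite -[X in X - _ - _ <= _]sum_prob /kill_prob -!sumrB; apply: ler_sum => t _.
rewrite -[X in X - _ - _]mulr1 -!mulrBr; apply: ler_wpM2l; first exact: prob_ge0.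
by case: (killed t u); case: (killed t v) => /=; lra.
Qed.

Lemma mean_color_weight_ge i :
  (1 - 2 * h) * color_weight w i <=
    \sum_t prob t * color_weight (new_weight t) i.
Proof.
have -> : \sum_t prob t * color_weight (new_weight t) i =
    \sum_u \sum_v (E i u v)%:R * (w u * w v) * (shrink u * shrink v *
      \sum_t prob t * ((~~ killed t u)%:R * (~~ killed t v)%:R)).
  under eq_bigr => t _ do rewrite mulr_sumr.
  rewrite exchange_big; apply: eq_bigr => u _ /=.
  under eq_bigr => t _ do rewrite mulr_sumr.
  rewrite exchange_big; apply: eq_bigr => v _ /=.
  rewrite mulr_sumr mulr_sumr; apply: eq_bigr => t _.
  by rewrite /new_weight; ring.
rewrite mulr_sumr; apply: ler_sum => u _.
rewrite mulr_sumr; apply: ler_sum => v _.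
by rewrite mulrC; apply: ler_wpM2l; rewrite ?survive_pair_ge // !mulr_ge0.
Qed.

Lemma color_weight_le t i :
  color_weight (new_weight t) i <= color_weight w i.
Proof.
apply: ler_sum => u _; apply: ler_sum => v _; apply: ler_wpM2l => //.
by apply: ler_pM; rewrite ?new_weight_ge0 ?new_weight_le.
Qed.

Lemma color_weight_drop t i :
  color_weight w i - color_weight (new_weight t) i <=
    2 * h * color_weight w i + 4.
Proof.
apply: (@color_weight_drop_le _ _ _ t.1.2 t.2) => u v.
have wuv : 0 <= w u * w v by rewrite mulr_ge0.
have wuv1 : w u * w v <= 1 by rewrite mulr_ile1.
have hw : 0 <= 2 * h * (w u * w v) by rewrite !mulr_ge0 ?(h_ge0 u).
rewrite /new_weight /killed.
have su := shrink_ge u; have sv := shrink_ge v.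
have suv : 1 - 2 * h <= shrink u * shrink v.
  have hh := h_ge0 u; have h1 := h_lt1; nra.
have : w u * w v - w u * shrink u * (w v * shrink v) <= 2 * h * (w u * w v).
  rewrite (_ : _ - _ = (1 - shrink u * shrink v) * (w u * w v)); last by ring.
  by apply: ler_wpM2r => //; lra.
case: (u == t.1.2); case: (u == t.2); case: (v == t.1.2); case: (v == t.2);
  rewrite /= ?mul0r ?mulr0 ?mul1r; lra.
Qed.

(** Rewriting the removal of a colour as an indicator gives a sum over a fixed index set, which can
    be averaged over the random colour. *)
Lemma wdegree_setD1 j (w' : T -> R) x :
  wdegree (C :\ j) w' x =
    \sum_(i in C) (i != j)%:R * \sum_y (E i x y)%:R * w' y.
Proof.
rewrite /wdegree [RHS]big_mkcond [LHS]big_mkcond /=; apply: eq_bigr => i _.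
rewrite in_setD1; case: (i != j); case: (i \in C); rewrite /= ?mul1r ?mul0r //.
Qed.

(** Inclusion-exclusion for the two events that colour [i] is picked and that [y] is covered; the
    last summand bounds the probability that both occur. *)
Lemma prob_avoid_le i y : i \in C ->
  \sum_t prob t * ((t.1.1 != i)%:R * (~~ killed t y)%:R) <=
    1 - k^-1 - kill_prob y + 2 / (k * S).
Proof.
move=> iC.
have -> : \sum_t prob t * ((t.1.1 != i)%:R * (~~ killed t y)%:R) =
    1 - k^-1 - kill_prob y + color_kill_prob i y.
  rewrite -(prob_color iC) -[X in _ = X - _ - _ + _]sum_prob -!sumrB -big_split /=.
  apply: eq_bigr => t _.
  by case: (t.1.1 == i); case: (killed t y) => /=; ring.
rewrite lerD2l (le_trans (color_kill_prob_le y iC)) //.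
rewrite ler_piMr //; first by rewrite ltW // divr_gt0 // mulr_gt0.
rewrite mulr_ile1 // ?sumr_ge0 // => [z _|]; first exact: mulr_ge0.
by apply: sum_subsingleton_le1 => // a b; exact: E_partner.
Qed.

(** The factor [shrink y] cancels the survival probability of [y] to exactly [1 - h]. The loss of
    the picked colour contributes the term in [1 / k], and the overlap of both events the correction
    [2 / S]. *)
Lemma mean_wdegree_le x :
  \sum_t prob t * wdegree (C :\ t.1.1) (new_weight t) x <=
    (1 - h - (1 - h - 2 / S) / k) * wdegree C w x.
Proof.
have -> : \sum_t prob t * wdegree (C :\ t.1.1) (new_weight t) x =
    \sum_(i in C) \sum_y (E i x y)%:R * w y * (shrink y *
      \sum_t prob t * ((t.1.1 != i)%:R * (~~ killed t y)%:R)).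
  under eq_bigr => t _ do rewrite wdegree_setD1 mulr_sumr.
  rewrite exchange_big; apply: eq_bigr => i _ /=.
  under eq_bigr => t _ do rewrite mulr_sumr mulr_sumr.
  rewrite exchange_big; apply: eq_bigr => y _ /=.
  rewrite mulr_sumr mulr_sumr; apply: eq_bigr => t _.
  by rewrite /new_weight eq_sym; ring.
rewrite /wdegree mulr_sumr; apply: ler_sum => i iC.
rewrite mulr_sumr; apply: ler_sum => y _.
rewrite [leRHS]mulrC; apply: ler_wpM2l; first exact: mulr_ge0.
apply: (le_trans (ler_wpM2l (shrink_ge0 y) (prob_avoid_le y iC))).
have -> : 1 - k^-1 - kill_prob y + 2 / (k * S) =
    (1 - kill_prob y) - k^-1 + 2 / (k * S) by ring.
rewrite mulrDr mulrBr {1}/shrink divfK ?gt_eqF //.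
have -> : 1 - h - (1 - h - 2 / S) / k = 1 - h - (1 - h) / k + 2 / (k * S).
  by rewrite invfM; ring.
apply: lerD; last by rewrite ler_piMl ?shrink_le1 // ltW // divr_gt0 // mulr_gt0.
by rewrite lerD2l lerN2 ler_wpM2r ?shrink_ge // invr_ge0 ltW.
Qed.

Lemma wdegree_le t x : wdegree (C :\ t.1.1) (new_weight t) x <= wdegree C w x.
Proof.
rewrite wdegree_setD1; apply: ler_sum => i _.
apply: (@le_trans _ _ (\sum_y (E i x y)%:R * new_weight t y)).
  rewrite ler_piMl ?lern1 ?leq_b1 // sumr_ge0 // => y _.
  by rewrite mulr_ge0 // new_weight_ge0.
by apply: ler_sum => y _; apply: ler_wpM2l; rewrite ?new_weight_le.
Qed.

Let color_le1 (D : {set I}) x y : \sum_(i in D) (E i x y)%:R <= 1 :> R.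
Proof.
under eq_bigr do rewrite -[_%:R]mulr1.
by apply: (@sum_subsingleton_le1 _ _ _ (fun i => E i x y)) => // a b;
   exact: E_color.
Qed.

Let col_deg_le x z : \sum_(i in C) \sum_y (E i x y)%:R * (y == z)%:R <= 1 :> R.
Proof.
rewrite exchange_big /=.
under eq_bigr => y _ do rewrite -mulr_suml mulrC.
by rewrite sum_indicator color_le1.
Qed.

(** Besides shrinking, three unit losses occur: the edge at [x] of the removed colour, and the edges
    from [x] to each of the two covered vertices. *)
Lemma wdegree_drop t x :
  wdegree C w x - wdegree (C :\ t.1.1) (new_weight t) x <=
    h * wdegree C w x + 3.
Proof.
apply: (@le_trans _ _ (h * wdegree C w x +
    (\sum_(i in C) (i == t.1.1)%:R * \sum_y (E i x y)%:R +
     \sum_(i in C) \sum_y (E i x y)%:R * (y == t.1.2)%:R +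
     \sum_(i in C) \sum_y (E i x y)%:R * (y == t.2)%:R))); last first.
  rewrite lerD2l.
  have := col_deg_le x t.1.2; have := col_deg_le x t.2.
  have : \sum_(i in C) (i == t.1.1)%:R * \sum_y (E i x y)%:R <= 1 :> R.
    apply: sum_subsingleton_le1 => [a b /eqP -> /eqP ->|i] //.
    exact: partner_sum_le1.
  lra.
rewrite wdegree_setD1 -sumrB mulr_sumr -!big_split /=; apply: ler_sum => i _.
rewrite !mulr_sumr -sumrB -!big_split /=; apply: ler_sum => y _.
rewrite [h * _]mulrCA ![_ * ((E i x y)%:R * _)]mulrCA [_ * (E i x y)%:R]mulrC.
rewrite -!mulrDr -mulrBr; apply: ler_wpM2l => //.
have hw : 0 <= h * w y by rewrite mulr_ge0 ?(h_ge0 y).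
have wy := w_le1 y.
rewrite /new_weight /killed.
have : w y - w y * shrink y <= h * w y.
  rewrite -{1}[w y]mulr1 -mulrBr mulrC ler_wpM2r //.
  by have := shrink_ge y; lra.
case: (i == _); case: (y == t.1.2); case: (y == t.2);
  rewrite /= ?mul0r ?mulr0 ?mul1r; lra.
Qed.

(** Colour weights must stay large and degrees small, hence the opposite signs in the exponents. The
    hypotheses on [la] and [mu] bound the one-step changes, and [kap] is the relative error this
    introduces into the mean changes. *)
Lemma nibble_step (V0 : {set T}) (la mu kap a b : R) :
  0 <= la -> 0 <= mu -> kap <= 1 -> 0 <= a -> 0 <= b ->
  (forall i, i \in C -> la * (2 * h * color_weight w i + 4) <= kap / 2) ->
  (forall x, mu * (h * wdegree C w x + 3) <= kap) ->
  exists i u v w',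
    [/\ i \in C, E i u v, 0 < w u & 0 < w v] /\
    [/\ w' u = 0, w' v = 0, forall x, 0 <= w' x & forall x, w' x <= w x] /\
    a * \sum_(j in C :\ i) expR (- (la * color_weight w' j)) +
      b * \sum_(x in V0) expR (mu * wdegree (C :\ i) w' x) <=
    a * \sum_(j in C)
        expR (- (la * ((1 - (1 + kap) * (2 * h)) * color_weight w j))) +
      b * \sum_(x in V0) expR (mu *
        ((1 - (1 - kap) * (h + (1 - h - 2 / S) / k)) * wdegree C w x)).
Proof.
move=> la0 mu0 kap1 a0 b0 la_b mu_b.
pose bound := a * \sum_(j in C)
    expR (- (la * ((1 - (1 + kap) * (2 * h)) * color_weight w j))) +
  b * \sum_(x in V0)
    expR (mu * ((1 - (1 - kap) * (h + (1 - h - 2 / S) / k)) * wdegree C w x)).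
have mean_weight j : j \in C ->
    \sum_t prob t * expR (- (la * color_weight (new_weight t) j)) <=
    expR (- (la * ((1 - (1 + kap) * (2 * h)) * color_weight w j))).
  move=> jC; pose X t := color_weight w j - color_weight (new_weight t) j.
  have X_ok t : 0 <= la * X t <= kap / 2.
    rewrite mulr_ge0 ?subr_ge0 ?color_weight_le //=.
    by apply: le_trans (la_b j jC); apply: ler_wpM2l; rewrite ?color_weight_drop.
  (* The sign of [kap] is read off from [X_ok] at some outcome; averaging the zero function provides
     one. *)
  have kap0 : 0 <= 1 + kap.
    by have [t _] := exists_le_mean prob_ge0 sum_prob (lexx (\sum_t prob t * 0));
       have /andP[] := X_ok t; lra.
  under eq_bigr => t _.
    rewrite (_ : - _ = la * X t - la * color_weight w j); last by rewrite /X; ring.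
    rewrite expRD mulrA.
    over.
  rewrite -mulr_suml.
  apply: (le_trans (ler_wpM2r (expR_ge0 _)
    (mean_expR_le prob_ge0 sum_prob X_ok kap1))).
  rewrite -expRD ler_expR.
  have : \sum_t prob t * X t <= 2 * h * color_weight w j.
    under eq_bigr do rewrite mulrBr.
    rewrite sumrB -mulr_suml sum_prob mul1r.
    by have := mean_color_weight_ge j; lra.
  move=> /(ler_wpM2l kap0) /(ler_wpM2l la0); lra.
have mean_deg x :
    \sum_t prob t * expR (mu * wdegree (C :\ t.1.1) (new_weight t) x) <=
    expR (mu * ((1 - (1 - kap) * (h + (1 - h - 2 / S) / k)) * wdegree C w x)).
  pose X t := wdegree C w x - wdegree (C :\ t.1.1) (new_weight t) x.
  have X_ok t : 0 <= mu * X t <= kap.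
    rewrite mulr_ge0 ?subr_ge0 ?wdegree_le //=.
    by apply: le_trans (mu_b x); apply: ler_wpM2l; rewrite ?wdegree_drop.
  under eq_bigr => t _.
    rewrite (_ : mu * _ = - (mu * X t) + mu * wdegree C w x);
      last by rewrite /X; ring.
    rewrite expRD mulrA.
    over.
  rewrite -mulr_suml.
  apply: (le_trans (ler_wpM2r (expR_ge0 _)
    (mean_expRN_le prob_ge0 sum_prob X_ok))).
  rewrite -expRD ler_expR.
  have : (h + (1 - h - 2 / S) / k) * wdegree C w x <= \sum_t prob t * X t.
    under eq_bigr do rewrite mulrBr.
    rewrite sumrB -mulr_suml sum_prob mul1r.
    by have := mean_wdegree_le x; lra.
  have kap0 : 0 <= 1 - kap by rewrite subr_ge0.
  move=> /(ler_wpM2l kap0) /(ler_wpM2l mu0); lra.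
have [|t [pt Ft]] := @exists_le_mean _ _ _ prob_ge0 sum_prob (fun t =>
    a * \sum_(j in C :\ t.1.1) expR (- (la * color_weight (new_weight t) j)) +
    b * \sum_(x in V0) expR (mu * wdegree (C :\ t.1.1) (new_weight t) x)) bound.
  under eq_bigr do rewrite mulrDr [prob _ * _]mulrCA [X in _ + X]mulrCA.
  rewrite big_split /= -!mulr_sumr; apply: lerD.
    apply: ler_wpM2l => //.
    (* Adding back the positive term of the picked colour makes the index set independent of the
       outcome. *)
    apply: (@le_trans _ _ (\sum_t \sum_(j in C)
        prob t * expR (- (la * color_weight (new_weight t) j)))).
      apply: ler_sum => t _; rewrite -mulr_sumr.
      apply: ler_wpM2l; first exact: prob_ge0.
      rewrite [leRHS]big_mkcond [leLHS]big_mkcond; apply: ler_sum => j _ /=.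
      rewrite in_setD1; case: (j != _); case: (j \in C) => //=.
    by rewrite exchange_big; apply: ler_sum => j jC; exact: mean_weight.
  apply: ler_wpM2l => //.
  under eq_bigr do rewrite mulr_sumr.
  by rewrite exchange_big; apply: ler_sum => x _; exact: mean_deg.
case: t pt Ft => [[i u] v] /= pt Ft.
exists i, u, v, (new_weight (i, u, v)); split; last split=> //.
  have [iC Euv wuv] : [/\ i \in C, E i u v & 0 < w u * w v].
    move: pt; rewrite /prob /=.
    case: (i \in C); last by rewrite !mul0r ltxx.
    case: (E i u v); last by rewrite mul0r mulr0 mul0r ltxx.
    have := mulr_ge0 (w_ge0 u) (w_ge0 v); rewrite le_eqVlt.
    by case/orP => [/eqP <-|//]; rewrite !mulr0 mul0r ltxx.
  have wu : w u != 0 by apply: contraTneq wuv => ->; rewrite mul0r ltxx.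
  have wv : w v != 0 by apply: contraTneq wuv => ->; rewrite mulr0 ltxx.
  by split=> //; rewrite lt_def ?wu ?wv w_ge0.
split; rewrite /new_weight /killed /= ?eqxx ?orbT ?mul0r // => x.
  exact: (new_weight_ge0 (i, u, v)).
exact: (new_weight_le (i, u, v)).
Qed.

End Step.
End Weights.

(** * Trajectories *)

(** To first order in [e] the left side is [1 - 167 / 200 * e] and the right side
    [1 - 127 / 200 * e]; the gap absorbs the higher order terms. This is where the degree slack pays
    for all errors in [hazardP]. *)
Lemma slack_le (R : realFieldType) (e : R) : 0 < e -> e <= 1 ->
  (1 + e / 50) ^+ 2 * (1 - 7 * e / 8) <=
  (1 - e / 100) * ((1 - e / 2) * (1 - e / 8)).
Proof.
move=> e0 e1; have e2 := exprn_gt0 2 e0.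
have : 0 <= e ^+ 2 * (1 - e) by rewrite mulr_ge0 ?subr_ge0 // ltW.
lra.
Qed.

(** Here [m] is the number of colours, [n] the size of each, [eps] the degree slack, [L] the
    exponent budget of the potential, and [k0] the number of colours left to the greedy phase. The
    last field makes the one-step changes of all exponents at most of order [kappa]. *)
Record admissible (R : realFieldType) (m n eps L k0 : R) : Prop := Admissible {
  adm_eps_gt0 : 0 < eps;
  adm_eps_le1 : eps <= 1;
  adm_L_ge1 : 1 <= L;
  adm_n_gt0 : 0 < n;
  adm_n_le : n <= 2 * m;
  adm_k0_gt0 : 0 < k0;
  adm_k0_le : 20 * k0 <= eps ^+ 2 * n;
  adm_n_large : L * (160 * m) ^+ 2 <= eps ^+ 4 * n * k0 ^+ 2
}.

Section Trajectories.

Variables (R : realFieldType) (m n eps L k0 : R).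
Hypothesis adm : admissible m n eps L k0.

Let eps_gt0 := adm_eps_gt0 adm.
Let eps_le1 := adm_eps_le1 adm.
Let L_ge1 := adm_L_ge1 adm.
Let n_gt0 := adm_n_gt0 adm.
Let n_le := adm_n_le adm.
Let k0_gt0 := adm_k0_gt0 adm.
Let k0_le := adm_k0_le adm.
Let n_large := adm_n_large adm.

Ltac hlra :=
  generalize eps_gt0 eps_le1 L_ge1 n_gt0 n_le k0_gt0 k0_le; intros; lra.

(* [kappa] bounds all the relative errors of a step. *)
Definition kappa : R := eps * (k0 / m) / 200.

(* The index [k] is the number of colours that are still unused, so it decreases
   from [m] to [k0] during the process. *)
Definition survival (k : R) : R := eps / 2 + (1 - eps / 2) * k / m.

Definition color_rate (k : R) : R := 4 * L / (eps * n) / survival k ^+ 2.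

(* The inverse of the expected trajectory of a degree, up to a constant; the
   shifts by [kappa] absorb the second order terms of the exponential moment. *)
Definition vertex_rate (k : R) : R :=
  8 * L / (eps * n) * m / ((survival k + 6 * kappa) * (k + 4 * kappa * m)).

(** The value of [h] with [k] colours left: the relative decrease of [survival] in the step, lowered
    by the factor [1 - 2 * kappa] to leave room for second order errors. *)
Definition hazard (k : R) : R :=
  (1 - 2 * kappa) * ((1 - eps / 2) / m / survival k).

(** The initial weight [2 * n] of a colour scaled by the squared survival, one factor for each end,
    less the tolerated deviation [eps / 8]. *)
Definition weight_low (k : R) : R := survival k ^+ 2 * (2 * n * (1 - eps / 8)).

Let m_gt0 : 0 < m. Proof. hlra. Qed.

(** In these two ratios [adm_n_large] reads [160 ^+ 2 * y <= eps ^+ 4 * r ^+ 2], so [y] is of order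
    at most [(eps * kappa) ^+ 2]. *)
Let r := k0 / m.
Let y := L / n.

Let r_gt0 : 0 < r. Proof. exact: divr_gt0. Qed.

Let r_le : 10 * r <= eps ^+ 2.
Proof.
rewrite mulrA ler_pdivrMr //.
have : eps ^+ 2 * n <= eps ^+ 2 * (2 * m) by rewrite ler_pM2l // exprn_gt0.
hlra.
Qed.

Let L_gt0 : 0 < L. Proof. hlra. Qed.

Let y_gt0 : 0 < y. Proof. exact: divr_gt0. Qed.

Let y_le : 160 ^+ 2 * y <= eps ^+ 4 * r ^+ 2.
Proof.
rewrite /y mulrA ler_pdivrMr //.
have -> : eps ^+ 4 * r ^+ 2 * n = eps ^+ 4 * n * k0 ^+ 2 / m ^+ 2.
  by rewrite /r; field; rewrite gt_eqF.
rewrite ler_pdivlMr ?exprn_gt0 //; apply: le_trans n_large.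
by rewrite exprMn le_eqVlt; apply/orP; left; apply/eqP; ring.
Qed.

Let invm_le : m^-1 <= 2 * y.
Proof.
rewrite /y mulrA ler_pdivlMr // mulrC ler_pdivrMr //.
have : 1 * m <= L * m by rewrite ler_pM2r.
hlra.
Qed.

Let invm_gt0 : 0 < m^-1. Proof. by rewrite invr_gt0. Qed.

Let kappaE : kappa = eps * r / 200. Proof. by []. Qed.

Let eps2_le1 : eps ^+ 2 <= 1. Proof. by rewrite expr_le1 // ltW. Qed.

Lemma kappa_gt0 : 0 < kappa.
Proof. by apply: divr_gt0; [exact: mulr_gt0|rewrite ltr0n]. Qed.

Lemma kappa_le : kappa <= eps / 200.
Proof.
have : eps * (10 * r) <= eps * 1 by rewrite ler_pM2l // (le_trans r_le).
rewrite kappaE; hlra.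
Qed.

Let y_le_kappa : 100 * y <= eps ^+ 3 * r * kappa.
Proof.
have : eps ^+ 3 * r * kappa = eps ^+ 4 * r ^+ 2 / 200 by rewrite kappaE; ring.
generalize y_le y_gt0; hlra.
Qed.

Let eps3_le : eps ^+ 3 * r * kappa <= eps ^+ 2 * kappa / 10.
Proof.
have e2 : 0 <= eps ^+ 2 * kappa by rewrite mulr_ge0 ?exprn_ge0 ?ltW ?kappa_gt0.
have er : eps * r <= 1 / 10.
  apply: (@le_trans _ _ (1 * r)); first by rewrite ler_pM2r.
  by generalize r_le eps2_le1; hlra.
have := ler_wpM2l e2 er.
hlra.
Qed.

Let y_le_kappa2 : 1000 * y <= eps ^+ 2 * kappa.
Proof. generalize y_le_kappa eps3_le; hlra. Qed.

Let shift_gt0 : 0 < 4 * kappa * m.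
Proof. by apply: mulr_gt0 => //; apply: mulr_gt0; rewrite ?kappa_gt0. Qed.

Lemma survival_gt k : 0 < k -> eps / 2 < survival k.
Proof.
move=> k_gt0; rewrite /survival ltrDl divr_gt0 // mulr_gt0 //; hlra.
Qed.

Lemma survival_le1 k : k <= m -> survival k <= 1.
Proof.
move=> km; rewrite /survival -lerBrDl ler_pdivrMr //.
rewrite ler_pM2l //; hlra.
Qed.

Lemma survivalB1 k : survival (k - 1) = survival k - (1 - eps / 2) / m.
Proof. by rewrite /survival; ring. Qed.

Section Index.

Variable k : R.
Hypotheses (k_ge : k0 <= k) (k_le : k <= m).

Let k_gt0 : 0 < k. Proof. exact: lt_le_trans k_ge. Qed.

Let p := survival k.

Let p_ge : eps / 2 <= p. Proof. exact/ltW/survival_gt. Qed.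

Let p_le1 : p <= 1. Proof. exact: survival_le1. Qed.

Let p_gt0 : 0 < p. Proof. by have := p_ge; hlra. Qed.

Let p2_ge : eps ^+ 2 / 4 <= p ^+ 2.
Proof.
have : (eps / 2) ^+ 2 <= p ^+ 2 by rewrite ler_sqr // nnegrE; generalize p_gt0; hlra.
rewrite expr_div_n; hlra.
Qed.

(** One step multiplies [survival] by [1 - x], and [hazard k] is [(1 - 2 * kappa) * x]. *)
Let x := (1 - eps / 2) / m / p.

Let x_ge0 : 0 <= x.
Proof. by rewrite !divr_ge0 // ?ltW //; hlra. Qed.

Let x_le : x <= 4 * y / eps.
Proof.
rewrite /x ler_pdivrMr // mulrAC ler_pdivlMr //.
have h1 : (1 - eps / 2) / m <= 1 * (2 * y).
  by apply: ler_pM => //; [hlra|exact: ltW|hlra].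
have h2 : 4 * y * (eps / 2) <= 4 * y * p by rewrite ler_pM2l // mulr_gt0.
have h3 := ler_wpM2r (ltW eps_gt0) h1.
hlra.
Qed.

Lemma hazard_ge0 : 0 <= hazard k.
Proof. by rewrite mulr_ge0 //; have := kappa_le; hlra. Qed.

Let hazard_le_step : hazard k <= x.
Proof. by rewrite ler_piMl //; have := kappa_gt0; hlra. Qed.

Let x_le_kappa : x <= kappa.
Proof.
apply: (le_trans x_le); rewrite ler_pdivrMr //.
have : eps * (eps * kappa) <= 1 * (eps * kappa).
  by rewrite ler_pM2r // mulr_gt0 // kappa_gt0.
generalize y_le_kappa2 y_gt0; hlra.
Qed.

Lemma hazard_le_kappa : hazard k <= kappa.
Proof. exact: le_trans hazard_le_step x_le_kappa. Qed.

Lemma hazardM_le : hazard k * n <= 4 / eps.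
Proof.
apply: (@le_trans _ _ (2 / eps * (m^-1 * n))); last first.
  have : m^-1 * n <= 2 by rewrite mulrC ler_pdivrMr.
  have e2 : 0 < 2 / eps by rewrite divr_gt0.
  by rewrite -(ler_pM2l e2); hlra.
rewrite mulrA ler_pM2r //; apply: (le_trans hazard_le_step).
rewrite /x ler_pdivrMr // mulrAC ler_pM2r //.
have : 2 / eps * (eps / 2) <= 2 / eps * p by rewrite ler_pM2l // divr_gt0.
have -> : 2 / eps * (eps / 2) = 1 by field; rewrite gt_eqF.
hlra.
Qed.

Lemma color_rate_ge0 : 0 <= color_rate k.
Proof. by rewrite !divr_ge0 ?mulr_ge0 ?exprn_ge0 // ltW. Qed.

Lemma color_rate_le : color_rate k <= 16 * y / eps ^+ 3.
Proof.
rewrite /color_rate ler_pdivrMr ?exprn_gt0 //.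
have -> : 4 * L / (eps * n) = 16 * y / eps ^+ 3 * (eps ^+ 2 / 4).
  by rewrite /y; field; rewrite !gt_eqF.
apply: ler_wpM2l; last exact: p2_ge.
apply: divr_ge0; last by rewrite exprn_ge0 // ltW.
by apply: mulr_ge0 => //; exact: ltW.
Qed.

Let eps_inv_ge1 : 1 <= eps^-1. Proof. by rewrite invf_ge1. Qed.

Lemma color_rate_bound (h s : R) : h * n <= 4 / eps -> 0 <= h -> s <= 2 * n ->
  color_rate k * (2 * h * s + 4) <= kappa / 2.
Proof.
move=> hn h0 s_le.
have hs : 2 * h * s <= 2 * h * (2 * n) by rewrite ler_wpM2l // mulr_ge0.
(* The absolute change is at most [4 * (h * n) + 4 <= 16 / eps + 4 / eps]. *)
apply: (@le_trans _ _ (16 * y / eps ^+ 3 * (20 / eps))).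
  apply: (@le_trans _ _ (color_rate k * (20 / eps))).
    apply: ler_wpM2l; first exact: color_rate_ge0.
    by generalize eps_inv_ge1 hn hs; hlra.
  by apply: ler_wpM2r; [rewrite divr_ge0 // ltW|exact: color_rate_le].
have -> : 16 * y / eps ^+ 3 * (20 / eps) = 320 * y / eps ^+ 4.
  by field; rewrite gt_eqF.
rewrite ler_pdivrMr ?exprn_gt0 //.
have r_le_eps : 10 * r <= eps.
  apply: (le_trans r_le); rewrite expr2 -[leRHS]mulr1.
  by apply: ler_wpM2l; first exact: ltW.
have c_ge0 : 0 <= eps ^+ 3 * kappa.
  by apply: mulr_ge0; [rewrite exprn_ge0 // ltW|exact/ltW/kappa_gt0].
have := ler_wpM2l c_ge0 r_le_eps; generalize y_le_kappa y_gt0.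
have : 0 <= eps ^+ 3 * kappa * eps by rewrite mulr_ge0 // ltW.
hlra.
Qed.

Lemma vertex_rate_ge0 : 0 <= vertex_rate k.
Proof.
have kg := kappa_gt0; apply: divr_ge0.
  by rewrite ltW // mulr_gt0 // divr_gt0 // mulr_gt0.
apply: mulr_ge0; last by rewrite addr_ge0 // ltW.
by rewrite -/p; have := p_ge; hlra.
Qed.

Lemma vertex_rate_le : vertex_rate k <= 16 * y / (eps ^+ 2 * r).
Proof.
have kg := kappa_gt0.
have q_gt0 : 0 < survival k + 6 * kappa by rewrite -/p; have := p_gt0; hlra.
have kK_gt0 : 0 < k + 4 * kappa * m.
  by rewrite addr_gt0.
rewrite /vertex_rate ler_pdivrMr ?mulr_gt0 //.
have -> : 8 * L / (eps * n) * m = 16 * y / (eps ^+ 2 * r) * (eps / 2 * k0).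
  by rewrite /y /r; field; rewrite !gt_eqF.
rewrite ler_pM2l; last first.
  by apply: divr_gt0; apply: mulr_gt0 => //; exact: exprn_gt0.
apply: ler_pM; [by rewrite divr_ge0 // ltW|exact: ltW| |].
  by rewrite -/p; have := p_ge; hlra.
by apply: (le_trans k_ge); rewrite lerDl ltW.
Qed.

Lemma vertex_rate_bound (h d : R) : h * n <= 4 / eps -> 0 <= h -> d <= n ->
  vertex_rate k * (h * d + 3) <= kappa.
Proof.
move=> hn h0 d_le.
have hd : h * d <= h * n by rewrite ler_wpM2l.
(* The absolute change is at most [4 / eps + 3 / eps]. *)
apply: (@le_trans _ _ (16 * y / (eps ^+ 2 * r) * (7 / eps))).
  apply: (@le_trans _ _ (vertex_rate k * (7 / eps))).
    apply: ler_wpM2l; first exact: vertex_rate_ge0.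
    by generalize eps_inv_ge1 hn hd; hlra.
  by apply: ler_wpM2r; [rewrite divr_ge0 // ltW|exact: vertex_rate_le].
have -> : 16 * y / (eps ^+ 2 * r) * (7 / eps) = 112 * y / (eps ^+ 3 * r).
  by field; rewrite !gt_eqF.
rewrite ler_pdivrMr ?mulr_gt0 ?exprn_gt0 //.
have := y_le; rewrite kappaE.
have -> : eps * r / 200 * (eps ^+ 3 * r) = eps ^+ 4 * r ^+ 2 / 200 by ring.
generalize y_gt0; hlra.
Qed.

Lemma weight_low_ge : 4 * k0 <= weight_low k.
Proof.
have : eps ^+ 2 / 4 * (2 * n * (7 / 8)) <= weight_low k.
  rewrite /weight_low; apply: ler_pM => //.
  - by rewrite divr_ge0 // exprn_ge0 // ltW.
  - by rewrite !mulr_ge0 // ltW.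
  - rewrite ler_pM2l ?mulr_gt0 //; hlra.
have : 0 < eps ^+ 2 * n by rewrite mulr_gt0 ?exprn_gt0.
generalize k0_le; hlra.
Qed.

Lemma weight_low_inv_le : 2 / weight_low k <= kappa.
Proof.
have w_ge := weight_low_ge; have kg := kappa_gt0.
rewrite ler_pdivrMr; last by apply: lt_le_trans w_ge; rewrite mulr_gt0.
apply: (@le_trans _ _ (kappa * (eps ^+ 2 / 4 * (2 * n * (7 / 8))))).
  have : 1 / n <= y by rewrite ler_pM2r ?invr_gt0.
  rewrite ler_pdivrMr // => yn.
  have := ler_wpM2r (ltW n_gt0) y_le_kappa2.
  hlra.
apply: ler_wpM2l; first exact: ltW.
rewrite /weight_low; apply: ler_pM => //.
- by rewrite divr_ge0 // exprn_ge0 // ltW.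
- by rewrite !mulr_ge0 // ltW.
- rewrite ler_pM2l ?mulr_gt0 //; hlra.
Qed.

(** The coefficient [4 * L / (eps * n)] makes a deviation by the fraction [eps / 8] of [2 * n] cost
    exactly [L] in the exponent. *)
Lemma weight_lowP s : 4 * L / (eps * n) * (2 * n) - color_rate k * s <= L ->
  weight_low k <= s.
Proof.
rewrite /color_rate -/p => s_ge; rewrite /weight_low -/p.
have c_gt0 : 0 < 4 * L / (eps * n) by rewrite divr_gt0 ?mulr_gt0.
rewrite mulrC -ler_pdivlMr ?exprn_gt0 // -(ler_pM2l c_gt0).
have -> : 4 * L / (eps * n) * (2 * n * (1 - eps / 8)) =
   4 * L / (eps * n) * (2 * n) - L by field; rewrite !gt_eqF.
rewrite lerBlDr -lerBlDl.
by rewrite [X in _ - X](_ : _ = 4 * L / (eps * n) / p ^+ 2 * s) //; ring.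
Qed.

(** Provides the hypothesis [hdeg] of a step. A degree excess of [eps * n / 8] costs exactly [L],
    which caps [d] by its trajectory with [1 - 7 * eps / 8] in place of [1 - eps]. The shifts by
    [kappa] enlarge the two trajectory factors by at most [1 + eps / 50] each, and [slack_le]
    absorbs them. *)
Lemma hazardP (D d : R) : 0 <= D -> D <= (1 - eps) * n ->
  vertex_rate k * d - vertex_rate m * D <= L ->
  2 * d / (k * weight_low k) <= hazard k.
Proof.
move=> D_ge0 D_le d_le.
have kg := kappa_gt0; have kl := kappa_le; have w_ge := weight_low_ge.
pose c := 8 * L / (eps * n).
have c_gt0 : 0 < c by rewrite divr_gt0 ?mulr_gt0.
pose q := p + 6 * kappa; pose kK := k + 4 * kappa * m.
have q_gt0 : 0 < q by rewrite /q; have := p_gt0; hlra.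
have kK_gt0 : 0 < kK by rewrite addr_gt0.
have sm : survival m = 1.
  by rewrite /survival mulfK ?gt_eqF //; hlra.
have den_gt0 : 0 < (1 + 6 * kappa) * (m + 4 * kappa * m).
  by apply: mulr_gt0; [hlra|rewrite addr_gt0].
have vm_ge0 : 0 <= vertex_rate m.
  by rewrite /vertex_rate sm ltW // divr_gt0 // mulr_gt0.
have vm_le : vertex_rate m <= c.
  rewrite /vertex_rate sm -/c ler_pdivrMr // ler_pM2l // -[leLHS]mul1r.
  apply: ler_pM; [exact: ler01|exact: ltW|hlra|].
  by rewrite lerDl ltW.
have d_bound : d <= q * kK / m * (n * (1 - 7 * eps / 8)).
  have : vertex_rate k * d <= c * (n * (1 - 7 * eps / 8)).
    have : vertex_rate m * D <= c * ((1 - eps) * n).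
      by apply: ler_pM.
    have -> : c * (n * (1 - 7 * eps / 8)) = c * ((1 - eps) * n) + L.
      by rewrite /c; field; rewrite !gt_eqF.
    by generalize d_le; hlra.
  have -> : vertex_rate k = c * (m / (q * kK)).
    by rewrite /vertex_rate -/c mulrA.
  rewrite -mulrA ler_pM2l //.
  have f_gt0 : 0 < q * kK / m by rewrite divr_gt0 // mulr_gt0.
  move=> /(ler_wpM2l (ltW f_gt0)).
  suff -> : q * kK / m * (m / (q * kK) * d) = d by [].
  by field; rewrite !gt_eqF.
rewrite ler_pdivrMr; last first.
  by rewrite mulr_gt0 //; apply: lt_le_trans w_ge; rewrite mulr_gt0.
have q_le : q <= p * (1 + eps / 50).
  have : 6 * kappa <= eps / 2 * (eps / 50).
    have : eps * (10 * r) <= eps * eps ^+ 2 by rewrite ler_pM2l.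
    have : eps ^+ 2 * eps <= eps ^+ 2 * 1 by rewrite ler_pM2l // exprn_gt0.
    by rewrite kappaE; have := exprn_gt0 2 eps_gt0; hlra.
  have : eps / 2 * (eps / 50) <= p * (eps / 50) by rewrite ler_pM2r // divr_gt0.
  by rewrite /q; hlra.
have kK_le : kK <= k * (1 + eps / 50).
  have -> : kK = k + eps * k0 / 50.
    by rewrite /kK kappaE /r; field; rewrite gt_eqF.
  have : eps * k0 <= eps * k by rewrite ler_pM2l.
  hlra.
have qkK : q * kK <= p * (1 + eps / 50) * (k * (1 + eps / 50)).
  by apply: ler_pM => //; exact: ltW.
have num : (1 + eps / 50) ^+ 2 * (1 - 7 * eps / 8) <=
    (1 - 2 * kappa) * ((1 - eps / 2) * (1 - eps / 8)).
  apply: (@le_trans _ _ ((1 - eps / 100) * ((1 - eps / 2) * (1 - eps / 8)))).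
    exact: slack_le.
  by apply: ler_wpM2r; [rewrite mulr_ge0 //; hlra|hlra].
apply: (@le_trans _ _ (2 * (p * k / m * n *
    ((1 + eps / 50) ^+ 2 * (1 - 7 * eps / 8))))).
  rewrite -mulrA ler_pM2l // (le_trans d_bound) //.
  have nm0 : 0 <= n * (1 - 7 * eps / 8) / m.
    by rewrite divr_ge0 ?mulr_ge0 ?ltW //; hlra.
  have := ler_wpM2r nm0 qkK; hlra.
have pk0 : 0 <= 2 * (p * k / m * n) by rewrite ltW // !(mulr_gt0, divr_gt0).
have := ler_wpM2l pk0 num.
suff -> : hazard k * (k * weight_low k) = 2 * (p * k / m * n) *
    ((1 - 2 * kappa) * ((1 - eps / 2) * (1 - eps / 8))) by hlra.
by rewrite /hazard /weight_low -/p; field; rewrite !gt_eqF.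
Qed.

(** After cancelling, this says that [(1 - x) ^+ 2] is at most the guaranteed mean contraction; the
    surplus [x ^+ 2] is paid for by the [kappa] terms since [x <= kappa]. *)
Lemma color_rate_step : 0 < survival (k - 1) ->
  color_rate k <= color_rate (k - 1) * (1 - (1 + kappa) * (2 * hazard k)).
Proof.
move=> p1_gt0; have kg := kappa_gt0.
have c_gt0 : 0 < 4 * L / (eps * n) by rewrite divr_gt0 ?mulr_gt0.
have p1E : survival (k - 1) = p * (1 - x).
  by rewrite survivalB1 -/p /x; field; rewrite !gt_eqF.
rewrite /color_rate -/p -[leRHS]mulrA ler_pM2l // [leRHS]mulrC.
rewrite ler_pdivlMr ?exprn_gt0 //.
rewrite p1E exprMn [leLHS]mulrA mulVf ?mul1r; last first.
  by rewrite gt_eqF // exprn_gt0.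
rewrite /hazard -/p -/x.
have : 0 <= x * (kappa - x) by rewrite mulr_ge0 ?subr_ge0.
have : 0 <= x * kappa by rewrite mulr_ge0 // ltW.
have : 0 <= x * kappa ^+ 2 by rewrite mulr_ge0 ?exprn_ge0 // ltW.
hlra.
Qed.

(** The contraction is compared with [(1 - (1 - eps / 2) / m / q) * (1 - 1 / kK)], one factor per
    trajectory factor. The errors amount to about [3 * kappa] in each; as [p <= 1] and [k <= m], the
    shifts [6 * kappa] and [4 * kappa * m] outweigh them. *)
Lemma vertex_rate_step : 0 < k - 1 ->
  vertex_rate (k - 1) *
    (1 - (1 - kappa) * (hazard k + (1 - hazard k - 2 / weight_low k) / k)) <=
  vertex_rate k.
Proof.
move=> k1_gt0; have kg := kappa_gt0; have kl := kappa_le.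
have k2 : 0 <= kappa * (1 / 200 - kappa) by apply: mulr_ge0; [exact: ltW|hlra].
pose c := 8 * L / (eps * n) * m.
have c_gt0 : 0 < c by rewrite mulr_gt0 // divr_gt0 // mulr_gt0.
pose q := p + 6 * kappa; pose kK := k + 4 * kappa * m.
have q_gt0 : 0 < q by rewrite /q; have := p_gt0; hlra.
have K_gt0 := shift_gt0.
have kK_gt0 : 0 < kK by rewrite addr_gt0.
have q1_gt0 : 0 < q - (1 - eps / 2) / m.
  have := survival_gt k1_gt0; rewrite survivalB1 -/p /q; hlra.
have kK1_gt0 : 0 < kK - 1 by rewrite /kK; hlra.
rewrite /vertex_rate -/c survivalB1 -/p.
rewrite (_ : p - (1 - eps / 2) / m + 6 * kappa = q - (1 - eps / 2) / m);
  last by rewrite /q; ring.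
rewrite (_ : k - 1 + 4 * kappa * m = kK - 1); last by rewrite /kK; ring.
rewrite -/q -/kK -[leLHS]mulrA ler_pM2l // mulrC ler_pdivrMr ?mulr_gt0 //.
rewrite [leRHS]mulrC ler_pdivlMr ?mulr_gt0 //.
have hz_ge : (1 - eps / 2) / m <= (1 - kappa) * hazard k * q.
  have -> : (1 - kappa) * hazard k * q =
      (1 - eps / 2) / m * ((1 - kappa) * (1 - 2 * kappa) * (q / p)).
    by rewrite /hazard -/p; field; rewrite !gt_eqF.
  rewrite -[leLHS]mulr1 ler_wpM2l //; first by rewrite divr_ge0 ?ltW //; hlra.
  rewrite mulrA ler_pdivlMr // mul1r /q.
  have : 0 <= kappa * (1 - p) by rewrite mulr_ge0 ?subr_ge0 // ltW.
  have : 0 <= kappa ^+ 2 * p by rewrite mulr_ge0 ?exprn_ge0 // ltW.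
  have : 0 <= kappa ^+ 3 by rewrite exprn_ge0 // ltW.
  hlra.
have card_ge : k <= (1 - kappa) * (1 - hazard k - 2 / weight_low k) * kK.
  have := hazard_le_kappa; have := weight_low_inv_le => wl hl.
  have : (1 - kappa) * (1 - 2 * kappa) <=
      (1 - kappa) * (1 - hazard k - 2 / weight_low k).
    by apply: ler_wpM2l; hlra.
  move=> /(ler_wpM2r (ltW kK_gt0)); apply: le_trans.
  rewrite /kK.
  have : 0 <= kappa * (m - k) by rewrite mulr_ge0 ?subr_ge0 // ltW.
  have : 0 <= kappa ^+ 2 * k by rewrite mulr_ge0 ?exprn_ge0 // ltW.
  have : 0 <= kappa ^+ 3 * m by rewrite mulr_ge0 ?exprn_ge0 // ltW.
  have := mulr_ge0 k2 (ltW m_gt0).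
  hlra.
pose z := (1 - kappa) * ((1 - hazard k - 2 / weight_low k) / k).
have z_ge : 1 <= z * kK.
  rewrite /z mulrA mulrAC ler_pdivlMr // mul1r; exact: card_ge.
have := ler_wpM2r (ltW kK_gt0) hz_ge.
have := ler_wpM2r (ltW q_gt0) z_ge.
have : 0 <= (1 - eps / 2) / m by rewrite divr_ge0 ?ltW //; hlra.
rewrite [(1 - kappa) * (_ + _)]mulrDr -/z.
hlra.
Qed.

End Index.
End Trajectories.

(** * The whole process *)

Section Process.

Variables (R : realType) (I T : finType) (E : I -> rel T).
Hypotheses (E_sym : forall i, symmetric (E i))
  (E_partner : forall i u v v', E i u v -> E i u v' -> v = v')
  (E_color : forall i j u v, E i u v -> E j u v -> i = j).

Lemma color_weight_mono (w w' : T -> R) i :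
  (forall x, 0 <= w x) -> (forall x, w x <= w' x) ->
  color_weight E w i <= color_weight E w' i.
Proof.
move=> w0 ww'; apply: ler_sum => u _; apply: ler_sum => v _.
by apply: ler_wpM2l => //; apply: ler_pM.
Qed.

Lemma wdegree_mono (C C' : {set I}) (w w' : T -> R) x :
  C \subset C' -> (forall x, 0 <= w x) -> (forall x, w x <= w' x) ->
  wdegree E C w x <= wdegree E C' w' x.
Proof.
move=> CC' w0 ww'; rewrite /wdegree big_mkcond [leRHS]big_mkcond /=.
apply: ler_sum => i _.
have sum_ge0 : 0 <= \sum_y (E i x y)%:R * w y.
  by apply: sumr_ge0 => y _; rewrite mulr_ge0.
have sum_le : \sum_y (E i x y)%:R * w y <= \sum_y (E i x y)%:R * w' y.
  by apply: ler_sum => y _; apply: ler_wpM2l.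
case: ifP => iC; first by rewrite (fintype.subsetP CC').
by case: ifP => // _; exact: le_trans sum_le.
Qed.

Lemma color_weight_ge0 (w : T -> R) i :
  (forall x, 0 <= w x) -> 0 <= color_weight E w i.
Proof.
by move=> w0; apply: sumr_ge0 => u _; apply: sumr_ge0 => v _; rewrite !mulr_ge0.
Qed.

Lemma wdegree_ge0 C (w : T -> R) x :
  (forall x, 0 <= w x) -> 0 <= wdegree E C w x.
Proof.
by move=> w0; apply: sumr_ge0 => i _; apply: sumr_ge0 => y _; rewrite mulr_ge0.
Qed.

Variables (n eps L D : R) (k0 : nat) (V0 : {set T}) (x0 : T).

Let m : R := #|I|%:R.

Hypotheses (adm : admissible m n eps L k0%:R) (k0_le_card : (k0 <= #|I|)%N)
  (full_weight : forall i, color_weight E (fun=> 1 : R) i = 2 * n)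
  (full_degree : forall x, wdegree E [set: I] (fun=> 1) x <= D)
  (D_le : D <= (1 - eps) * n)
  (V0P : forall x, x \notin V0 -> wdegree E [set: I] (fun=> 1 : R) x = 0)
  (L_large : #|I|%:R + #|V0|%:R <= expR L).

Let k0_gt0 : (0 < k0)%N. Proof. by have := adm_k0_gt0 adm; rewrite ltr0n. Qed.

Let D_ge0 : 0 <= D.
Proof. exact: le_trans (wdegree_ge0 _ x0 (fun=> ler01)) (full_degree x0). Qed.

Let lamb := color_rate m n eps L.
Let muv := vertex_rate m n eps L k0%:R.
Let haz := hazard m eps k0%:R.
Let low := weight_low m n eps.
Let kap := kappa m eps k0%:R.

(** The prefactors normalise every summand to at most 1 at the start, so the initial value is at
    most [expR L]; later a bound by [expR L] limits each exponent by [L]. Summing over [V0] keeps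
    isolated vertices, of which there may be arbitrarily many, out of the count. *)
Definition potential (k : R) (C : {set I}) (w : T -> R) : R :=
  expR (4 * L / (eps * n) * (2 * n)) *
    \sum_(i in C) expR (- (color_rate m n eps L k * color_weight E w i)) +
  expR (- (vertex_rate m n eps L k0%:R m * D)) *
    \sum_(x in V0) expR (vertex_rate m n eps L k0%:R k * wdegree E C w x).

Let potential_weight k C w i : potential k C w <= expR L -> i \in C ->
  4 * L / (eps * n) * (2 * n) - lamb k * color_weight E w i <= L.
Proof.
move=> pot iC; rewrite -ler_expR expRD; apply: le_trans pot.
rewrite /potential -[leLHS]addr0 lerD //; last first.
  by rewrite mulr_ge0 ?expR_ge0 // sumr_ge0 // => x _; exact: expR_ge0.
rewrite ler_pM2l ?expR_gt0 // (bigD1 i) //= lerDl.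
by rewrite sumr_ge0 // => j _; exact: expR_ge0.
Qed.

Let potential_degree k C w x : (forall x, 0 <= w x) -> (forall x, w x <= 1) ->
  potential k C w <= expR L -> muv k * wdegree E C w x - muv m * D <= L.
Proof.
move=> w0 w1 pot.
have vm_ge0 : 0 <= muv m.
  by apply: (vertex_rate_ge0 adm); rewrite ler_nat.
case: (boolP (x \in V0)) => xV0; last first.
  have -> : wdegree E C w x = 0.
    apply/eqP; rewrite eq_le wdegree_ge0 // -(V0P xV0) andbT.
    exact: wdegree_mono.
  have := mulr_ge0 vm_ge0 D_ge0; have := adm_L_ge1 adm; lra.
rewrite -ler_expR expRD mulrC; apply: le_trans pot.
rewrite /potential -[leLHS]add0r lerD //.
  by rewrite mulr_ge0 ?expR_ge0 // sumr_ge0 // => i _; exact: expR_ge0.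
rewrite ler_pM2l ?expR_gt0 // (bigD1 x) //= lerDl.
by rewrite sumr_ge0 // => j _; exact: expR_ge0.
Qed.

(** [N] counts the remaining random steps. At [N = 0] the bound [4 * k0%:R <= low k] hands over to
    the greedy phase. *)
Lemma nibble_induction N (C : {set I}) (w : T -> R) :
  #|C| = (k0 + N)%N -> (forall x, 0 <= w x) -> (forall x, w x <= 1) ->
  potential #|C|%:R C w <= expR L -> rainbow_on E C w.
Proof.
elim: N C w => [|N IH] C w card_C w0 w1; set k := #|C|%:R => pot.
all: have k_ge : k0%:R <= k by rewrite ler_nat card_C leq_addr.
all: have k_le : k <= m by rewrite ler_nat max_card.
all: have low_ge : 4 * k0%:R <= low k by exact: (weight_low_ge adm).
all: have weight_ge i (iC : i \in C) : low k <= color_weight E w i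
  by apply: (weight_lowP adm) => //; exact: (potential_weight pot iC).
  apply: greedy_rainbow => // i iC; apply: le_trans (weight_ge i iC).
  by rewrite card_C addn0.
have kB1 : k - 1 = (k0 + N)%:R by rewrite /k card_C addnS -natr1 addrK.
have k1_ge : k0%:R <= k - 1 by rewrite kB1 ler_nat leq_addr.
have k1_le : k - 1 <= m by rewrite (le_trans _ k_le) // gerBl.
have k1_gt0 : 0 < k - 1 by exact: lt_le_trans (adm_k0_gt0 adm) k1_ge.
have low_gt0 : 0 < low k.
  by apply: lt_le_trans low_ge; rewrite mulr_gt0 // (adm_k0_gt0 adm).
have kap_le : kap <= eps / 200 by exact: (kappa_le adm).
have kap_gt0 : 0 < kap by exact: (kappa_gt0 adm).
have haz_le : haz k <= kap by exact: (hazard_le_kappa adm k_ge).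
have haz_ge0 : 0 <= haz k by exact: (hazard_ge0 adm k_ge).
have hazM : haz k * n <= 4 / eps by exact: (hazardM_le adm k_ge).
have hdeg x : 2 * wdegree E C w x / (#|C|%:R * low k) <= haz k.
  apply: (hazardP adm k_ge D_ge0 D_le).
  exact: (potential_degree _ w0 w1 pot).
have haz_lt1 : haz k < 1 by have := adm_eps_le1 adm; lra.
have C_gt0 : (0 < #|C|)%N by rewrite card_C addnS.
have weight_le i : color_weight E w i <= 2 * n.
  by rewrite -(full_weight i); apply: color_weight_mono.
have deg_le x : wdegree E C w x <= n.
  apply: (@le_trans _ _ D).
    by apply: le_trans (full_degree x); apply: wdegree_mono; rewrite ?finset.subsetT.
  apply: le_trans D_le _; rewrite ler_piMl ?(ltW (adm_n_gt0 adm)) // gerBl.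
  exact: ltW (adm_eps_gt0 adm).
have lamb_ge0 : 0 <= lamb (k - 1) by exact: (color_rate_ge0 adm k1_ge).
have mu_ge0 : 0 <= muv (k - 1) by exact: (vertex_rate_ge0 adm k1_ge).
have kap_le1 : kap <= 1 by have := adm_eps_le1 adm; lra.
have lamb_ok i : i \in C ->
    lamb (k - 1) * (2 * haz k * color_weight E w i + 4) <= kap / 2.
  by move=> iC; apply: (color_rate_bound adm k1_ge).
have mu_ok x : muv (k - 1) * (haz k * wdegree E C w x + 3) <= kap.
  by apply: (vertex_rate_bound adm k1_ge).
have [i [u [v [w' [[iC Euv wu wv] [[w'u w'v w'0 w'w] pot_le]]]]]] :=
  nibble_step E_sym E_partner E_color w0 w1 low_gt0 weight_ge C_gt0 hdeg haz_lt1
    V0 lamb_ge0 mu_ge0 kap_le1 (expR_ge0 (4 * L / (eps * n) * (2 * n)))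
    (expR_ge0 (- (muv m * D))) lamb_ok mu_ok.
apply: (rainbow_on_setD1 Euv wu wv w'w w'u w'v).
have card_C' : #|C :\ i| = (k0 + N)%N.
  by move: card_C; rewrite (cardsD1 i) iC addnS => -[].
apply: IH => // [x|]; first exact: le_trans (w'w x) _.
rewrite card_C' -kB1; apply: (le_trans pot_le); apply: le_trans pot.
(* Termwise, the rate at [k - 1] times the contraction is compared with the rate at [k]. *)
apply: lerD; (apply: ler_wpM2l; first exact: expR_ge0); apply: ler_sum.
  move=> j jC; rewrite ler_expR lerN2 [leRHS]mulrA.
  apply: ler_wpM2r; first exact: color_weight_ge0.
  apply: (color_rate_step adm k_ge); apply: lt_trans (survival_gt adm k1_gt0).
  by rewrite divr_gt0 ?(adm_eps_gt0 adm).
move=> x _; rewrite ler_expR [leLHS]mulrA.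
by apply: ler_wpM2r; [exact: wdegree_ge0|exact: (vertex_rate_step adm k_ge)].
Qed.

Lemma nibble_rainbow : rainbow_on E [set: I] (fun=> 1 : R).
Proof.
apply: (@nibble_induction (#|I| - k0)) => //; first by rewrite cardsT subnKC.
rewrite cardsT; apply: le_trans L_large.
have sm : survival m eps m = 1.
  have m0 : 0 < m by rewrite ltr0n (leq_trans k0_gt0).
  by rewrite /survival mulfK ?gt_eqF //; lra.
apply: lerD.
  rewrite mulr_sumr (eq_bigr (fun=> 1)) => [|i _].
    by rewrite sumr_const cardsT.
  by rewrite -expRD full_weight /color_rate -/m sm expr1n divr1 subrr expR0.
apply: (@le_trans _ _ (\sum_(x in V0) 1)); last by rewrite sumr_const.
rewrite mulr_sumr; apply: ler_sum => x _.
rewrite -expRD expR_le1 addrC subr_le0.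
apply: ler_wpM2l; last exact: full_degree.
by apply: (vertex_rate_ge0 adm); rewrite ler_nat.
Qed.

End Process.

(** * From matchings to weights *)

Section Graphs.

Variable T : finType.
Implicit Types (G : {set {set T}}) (u v x : T).

Lemma sum_edges_at (R : pzSemiRingType) G x : (forall e, e \in G -> #|e| = 2) ->
  \sum_v ([set x; v] \in G)%:R = (degree G x)%:R :> R.
Proof.
move=> G2; rewrite -natr_sum /degree; congr _%:R.
have inj : {in [set v | [set x; v] \in G] &, injective (fun v => [set x; v])}.
  move=> v v'; rewrite !inE => Gv Gv' eq_vv'.
  have : v \in [set x; v'] by rewrite -eq_vv' set22.
  case/set2P => // vx; have := G2 _ Gv.
  by rewrite vx finset.setUid cards1.
rewrite -big_mkcond sum1_card.
transitivity #|[set v | [set x; v] \in G]|.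
  by apply: eq_card => v; rewrite inE.
rewrite -(card_in_imset inj); apply: eq_card => e.
apply/imsetP/idP => [[v]|].
  by rewrite inE => Gv ->; rewrite inE Gv set21.
rewrite inE => /andP[Ge xe]; have /eqP/cards2P[a [b [ab e_ab]]] := G2 e Ge.
move: xe Ge; rewrite e_ab => /set2P[] <- Ge.
  by exists b; rewrite ?inE.
by exists a; rewrite ?inE finset.setUC.
Qed.

Lemma sum_degree G : (forall e, e \in G -> #|e| = 2) ->
  (\sum_v degree G v = 2 * #|G|)%N.
Proof.
move=> G2; rewrite /degree.
under eq_bigr => v _.
  rewrite -sum1_card (eq_bigl (fun e => (e \in G) && (v \in e))); last first.
    by move=> e; rewrite inE.
  rewrite big_mkcondr.
  over.
rewrite exchange_big /= (eq_bigr (fun=> 2)) => [|e Ge].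
  by rewrite sum_nat_const mulnC.
by rewrite -big_mkcond sum1_card G2.
Qed.

Variables (m : nat) (M : 'I_m -> {set {set T}}).
Hypotheses (M_matching : forall i, is_matching (M i))
  (M_disjoint : non_intersecting M).

Definition joins (i : 'I_m) : rel T := fun u v => [set u; v] \in M i.

Lemma card_edge i e : e \in M i -> #|e| = 2.
Proof. by have /andP[/forall_inP/(_ e) H _] := M_matching i => /H /eqP. Qed.

Lemma card_family_edge e : e \in family_edges M -> #|e| = 2.
Proof. by case/finset.bigcupP => i _; exact: card_edge. Qed.

Lemma joins_sym i : symmetric (joins i).
Proof. by move=> u v; rewrite /joins finset.setUC. Qed.

Lemma joins_partner i u v v' : joins i u v -> joins i u v' -> v = v'.
Proof.
rewrite /joins => Mv Mv'; have /andP[_ /finset.trivIsetP disj] := M_matching i.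
have eq_vv' : [set u; v] = [set u; v'].
  apply: contraTeq isT => /(disj _ _ Mv Mv') /disjointFr /(_ (set21 u v)).
  by rewrite set21.
have : v \in [set u; v'] by rewrite -eq_vv' set22.
case/set2P => // vu; have := card_edge Mv.
by rewrite vu finset.setUid cards1.
Qed.

Lemma edge_color i j e : e \in M i -> e \in M j -> i = j.
Proof.
move=> ei ej; apply/eqP; case: (ltngtP i j) => // ij.
- by have /setP/(_ e) := M_disjoint ij; rewrite !inE ei ej.
- by have /setP/(_ e) := M_disjoint ij; rewrite !inE ei ej.
- by apply/eqP/val_inj.
Qed.

Lemma joins_color i j u v : joins i u v -> joins j u v -> i = j.
Proof. exact: edge_color. Qed.

Lemma full_color_weight (R : realType) i :
  color_weight joins (fun=> 1 : R) i = (2 * #|M i|)%:R.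
Proof.
rewrite -(sum_degree (@card_edge i)) natr_sum; apply: eq_bigr => u _.
rewrite -(sum_edges_at _ _ (@card_edge i)); apply: eq_bigr => v _.
by rewrite !mulr1.
Qed.

(** Disjointness of the matchings enters here: a neighbour of [x] is counted for one colour only. *)
Lemma full_wdegree_le (R : realType) x :
  wdegree joins [set: 'I_m] (fun=> 1 : R) x <= (degree (family_edges M) x)%:R.
Proof.
rewrite -(sum_edges_at _ _ card_family_edge) /wdegree exchange_big /=.
apply: ler_sum => y _.
case: (boolP (_ \in family_edges M)) => [_|notM].
  by apply: sum_subsingleton_le1 => // i j; exact: joins_color.
rewrite big1 // => i _; case: (boolP (joins i x y)) => [Exy|]; last by rewrite mul0r.
by case/finset.bigcupP: notM; exists i.
Qed.

Lemma card_family_edges n : (forall i, #|M i| = n) -> (#|family_edges M| <= m * n)%N.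
Proof.
move=> Mn; apply: leq_trans (_ : \sum_(i < m) #|M i| <= _)%N.
  rewrite /family_edges; elim/big_rec2: _ => [|i s A _ IH]; first by rewrite cards0.
  by rewrite cardsU (leq_trans (leq_subr _ _)) // leq_add2l.
by under eq_bigr do rewrite Mn; rewrite sum_nat_const card_ord.
Qed.

Lemma full_rainbow_of (R : realType) :
  rainbow_on joins [set: 'I_m] (fun=> 1 : R) -> exists N, full_rainbow_matching M N.
Proof.
move=> [f [f_edge f_disj]].
pose e i := [set (f i).1; (f i).2].
have Me i : e i \in M i by have [|] := f_edge i; rewrite ?inE.
have in_e i x : x \in e i -> endpoint (f i) x by rewrite !inE.
exists [set e i | i : 'I_m]; split.
- apply/andP; split.
    by apply/forall_inP => _ /imsetP[i _ ->]; rewrite (card_edge (Me i)).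
  apply/finset.trivIsetP => _ _ /imsetP[i _ ->] /imsetP[j _ ->] eij.
  rewrite -setI_eq0; apply: contraNT eij => /set0Pn[x /setIP[xi xj]].
  by rewrite (f_disj i j x) ?inE //; exact: in_e.
- by apply/fintype.subsetP => _ /imsetP[i _ ->]; apply/finset.bigcupP; exists i.
move=> i; apply/eqP/cards1P; exists (e i); apply/setP => g; rewrite !inE.
apply/andP/eqP => [[/imsetP[j _ ->] Mij]|->]; last by rewrite imset_f ?Me.
by rewrite (edge_color Mij (Me j)).
Qed.

End Graphs.

(** * Choice of the parameters, and the theorem *)

Lemma powR_expn (R : realType) (x a : R) k : (x `^ a) ^+ k = x `^ (a * k%:R).
Proof. by rewrite -powR_mulrn ?powR_ge0 // powRrM. Qed.

(** With [eps = n]^ (- c)[,]t = n [^ (1 / 10)], [L = 40 * t] and [k0] the integer part of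
    [eps ^+ 2 * n / 20], every requirement becomes a comparison of powers of [n]. *)
Lemma admissible_eventually (R : realType) (delta c : R) :
  0 <= delta -> 0 < c -> c < (1 - 4 * delta) / 10 ->
  exists n0 : nat, forall n m : nat, (n0 <= n)%N -> (n <= 2 * m)%N ->
    m%:R <= n%:R `^ (1 + delta) ->
    exists (L : R) (k0 : nat),
      [/\ admissible m%:R n%:R (n%:R `^ (- c)) L k0%:R, (k0 <= m)%N &
        m%:R + (2 * (m * n))%:R <= expR L].
Proof.
move=> d0 c0 c_lt.
(* [A] collects the constants of [adm_n_large]; for [n >= A ^+ 10] a single factor [t] dominates
   it. *)
pose A : R := 40 * (160 * 40) ^+ 2.
have A40 : 40 <= A by rewrite ler_pMr // expr_ge1 // ; lra.
exists (Num.bound (A ^+ 10)).+1 => n m n0n nm m_le.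
set x : R := n%:R.
have x_ge : A ^+ 10 <= x.
  apply: (@le_trans _ _ (Num.bound (A ^+ 10))%:R).
    by apply/ltW/archi_boundP; rewrite exprn_ge0 //; lra.
  by rewrite ler_nat ltnW.
have A_ge1 : 1 <= A by lra.
have x1 : 1 <= x by apply: le_trans x_ge; exact: exprn_ege1.
have x0 : 0 < x by lra.
have powD a b : x `^ (a + b) = x `^ a * x `^ b.
  by rewrite powRD //; apply/implyP => _; rewrite gt_eqF.
have pow_mono a b : a <= b -> x `^ a <= x `^ b by exact: ler_powR.
pose t := x `^ (1 / 10).
have tA : A <= t.
  have -> : A = (A ^+ 10) `^ (1 / 10).
    rewrite -powR_mulrn ?(le_trans ler01) // -powRrM mulrC divfK // powRr1 //.
    lra.
  by apply: ge0_ler_powR; rewrite ?nnegrE ?exprn_ge0 //; lra.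
set eps := x `^ (- c).
have eps0 : 0 < eps by exact: powR_gt0.
have eps1 : eps <= 1 by rewrite /eps -[leRHS](powRr0 x); apply: pow_mono; lra.
have x2 : t ^+ 2 <= eps ^+ 2 * x.
  rewrite -[X in _ * X]powRr1 ?(ltW x0) // /t /eps !powR_expn -powD.
  apply: pow_mono; lra.
have t0 : 0 < t by lra.
have t2 : 40 <= t ^+ 2.
  have : t * 1 <= t * t by rewrite ler_pM2l //; lra.
  by rewrite expr2; lra.
pose z := eps ^+ 2 * x / 20.
have z2 : 2 <= z by rewrite /z; lra.
have /andP[k0_le k0_gt] := truncn_itv (ltW (lt_le_trans (ltr0n R 2) z2)).
set k0 := Num.truncn z in k0_le k0_gt *.
have k0_ge : z / 2 <= k0%:R by move: k0_gt; rewrite -natr1; lra.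
have xm : x <= 2 * m%:R by rewrite -natrM ler_nat.
exists (40 * t), k0; split.
- split => //.
  + by lra.
  + by lra.
  + by move: k0_le; rewrite /z; lra.
  (* The exponents satisfy [1 / 5 + 2 * (1 + delta) <= 3 - 8 * c], by the upper bound on [c]. *)
  have big : t ^+ 2 * m%:R ^+ 2 <= eps ^+ 8 * x ^+ 3.
    apply: (@le_trans _ _ (t ^+ 2 * (x `^ (1 + delta)) ^+ 2)).
      apply: ler_wpM2l; first exact: sqr_ge0.
      by rewrite ler_sqr ?nnegrE ?powR_ge0.
    rewrite -[x ^+ 3]powR_mulrn ?(ltW x0) // /t /eps !powR_expn -!powD.
    apply: pow_mono; lra.
  apply: (@le_trans _ _ (eps ^+ 4 * x * (z / 2) ^+ 2)); last first.
    apply: ler_wpM2l; first by rewrite mulr_ge0 ?exprn_ge0 // ltW.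
    by rewrite ler_sqr ?nnegrE //; lra.
  have -> : eps ^+ 4 * x * (z / 2) ^+ 2 = eps ^+ 8 * x ^+ 3 / 40 ^+ 2.
    by rewrite /z; field.
  rewrite ler_pdivlMr ?exprn_gt0 //; apply: le_trans big.
  have -> : 40 * t * (160 * m%:R) ^+ 2 * 40 ^+ 2 = A * t * m%:R ^+ 2.
    by rewrite /A; ring.
  apply: ler_wpM2r; first exact: sqr_ge0.
  by rewrite expr2 ler_pM2r.
- rewrite -(ler_nat R) (le_trans k0_le) // /z.
  have : eps ^+ 2 * x <= 1 * x by rewrite ler_pM2r // expr_le1 // ltW.
  lra.
have mx : m%:R <= x ^+ 2.
  apply: (le_trans m_le); rewrite -/x -powR_mulrn ?(ltW x0) //; apply: pow_mono; lra.
apply: (@le_trans _ _ (x ^+ 4)).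
  rewrite natrM natrM -/x.
  have h1 : m%:R * x <= x ^+ 2 * x by rewrite ler_pM2r.
  have h2 : x ^+ 2 * 1 <= x ^+ 2 * x by rewrite ler_pM2l // exprn_gt0.
  have h3 : x ^+ 3 * 3 <= x ^+ 3 * x.
    rewrite ler_pM2l ?exprn_gt0 //; apply: le_trans x_ge.
    have : A ^+ 1 <= A ^+ 10 by apply: ler_weXn2l.
    by rewrite expr1; lra.
  lra.
(* The factor 40 in [L] is [10 * 4]: [expR (40 * t) >= t ^+ 40 = n ^+ 4]. *)
have tx : t ^+ 10 = x by rewrite /t powR_expn divfK ?pnatr_eq0 // powRr1 // ltW.
rewrite -tx -exprM; have -> : 40 * t = t * (10 * 4)%:R by rewrite mulrC natrM.
rewrite expRM_natr; apply: lerXn2r; rewrite ?nnegrE ?expR_ge0 ?ltW //.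
by apply: lt_le_trans (expR_ge1Dx t); lra.
Qed.

Theorem theorem2p1 (R : realType) (delta c : R)
    (delta_ge0 : 0 <= delta) (delta_lt : delta < 1 / 4)
    (c_gt0 : 0 < c) (c_lt : c < (1 - 4 * delta) / 10) :
  exists n0 : nat, forall n : nat, (n0 <= n)%N ->
    forall (T : finType) (m : nat) (M : 'I_m -> {set {set T}}),
      (forall i, is_matching (M i)) ->
      (forall i, #|M i| = n) ->
      non_intersecting M ->
      m%:R <= (1 - n%:R `^ (- c)) * n%:R `^ (1 + delta) ->
      (max_degree (family_edges M))%:R <= (1 - n%:R `^ (- c)) * n%:R ->
      exists N : {set {set T}}, full_rainbow_matching M N.
Proof.
have [n0 admP] := admissible_eventually delta_ge0 c_gt0 c_lt.
exists n0.+1 => n n0n T m M M_matching Mn M_disj m_le deg_le.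
have n_gt0 : (0 < n)%N by apply: leq_ltn_trans n0n.
case: m M M_matching Mn M_disj m_le deg_le => [|m'] M M_matching Mn M_disj.
  move=> _ _; exists finset.set0; split=> [||[]//]; last exact: finset.sub0set.
  by apply/andP; split; [apply/forall_inP => e|apply/finset.trivIsetP => e e'];
    rewrite inE.
set m := m'.+1 in M M_matching Mn M_disj * => m_le deg_le.
have [x0 _] : exists x0 : T, true.
  have /card_gt0P[e Me] : (0 < #|M ord0|)%N by rewrite Mn.
  have /card_gt0P[x0 _] : (0 < #|e|)%N by rewrite (card_edge M_matching Me).
  by exists x0.
have weight1 i : color_weight (joins M) (fun=> 1 : R) i = 2 * n%:R.
  by rewrite full_color_weight // Mn natrM.
apply: (full_rainbow_of M_matching M_disj (R := R)).
(* If [2 * m < n], the initial weight [2 * n] of each colour exceeds [4 * m] and the greedy argument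
   suffices. *)
case: (leqP n (2 * m)) => nm; last first.
  apply: (greedy_rainbow (@joins_sym T m M) (joins_partner M_matching) x0) => //.
  move=> i _; rewrite weight1 cardsT card_ord.
  by rewrite -!natrM ler_nat -(mulnA 2 2) leq_mul2l ltnW.
have m_le' : m%:R <= n%:R `^ (1 + delta) :> R.
  apply: (le_trans m_le); apply: ler_piMl; first exact: powR_ge0.
  by have := powR_ge0 (n%:R : R) (- c); lra.
have [L [k0 [adm k0m L_large]]] := admP n m (ltnW n0n) nm m_le'.
pose V0 := [set x | 0 < degree (family_edges M) x]%N.
apply: (@nibble_rainbow R 'I_m T (joins M) (@joins_sym T m M)
  (joins_partner M_matching) (joins_color M_disj)
  n%:R (n%:R `^ (- c)) L (max_degree (family_edges M))%:R k0 V0 x0);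
  rewrite ?card_ord //.
- move=> x; apply: le_trans (full_wdegree_le M_matching M_disj R x) _.
  by rewrite ler_nat; exact: leq_bigmax.
- move=> x; rewrite inE -eqn0Ngt => /eqP deg0.
  apply/eqP; rewrite eq_le wdegree_ge0 // andbT.
  by have := full_wdegree_le M_matching M_disj R x; rewrite deg0.
(* Each vertex of [V0] has degree at least 1, so [V0] is no larger than the degree sum, which is at
   most [2 * (m * n)]. *)
apply: le_trans L_large; rewrite -natrD -natrD ler_nat leq_add2l.
apply: (@leq_trans (2 * #|family_edges M|)); last first.
  by rewrite leq_mul2l card_family_edges.
rewrite -(sum_degree (card_family_edge M_matching)).
rewrite -sum1_card big_mkcond; apply: leq_sum => x _.
by rewrite inE; case: ltnP.
Qed.
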